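(* Let $p$ be a prime, $n\ge 1$, $d_1\geq d_2\ge\dots\geq d_n\geq 0$ integers, and $d=\sum_{i=1}^n d_i$. Isomorphism classes in $\mathbf{AbSol}(p^{d_1},\dots,p^{d_n})$ are in bijective correspondence with orbits of the action of $\mathrm{Aut}(F_{n,p^d}^* )$ on $\mathcal{M}(p^{d_1},\dots,p^{d_n})$. In particular, writing $|\mathbf{AbSol}(p^{d_1},\dots,p^{d_n})|$ for the number of isomorphism classes in $\mathbf{AbSol}(p^{d_1},\dots,p^{d_n})$ and $\mathcal{O}(M)$ for the orbit of $M$ under this action, $$|\mathbf{AbSol}(p^{d_1},\dots,p^{d_n})|=\sum_{M\in \mathcal{M}(p^{d_1},\dots,p^{d_n})}\frac{1}{|\mathcal{O}(M)|}.$$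
   Context: $\mathcal{M}(p^{d_1},\dots,p^{d_n})$ is the set of all $n\times n$ matrices $M$ such that: (1) $M$ is upper triangular; (2) all entries of $M$ are non-negative integers; (3) every diagonal element is strictly greater than every other element in the same column; (4) for every $1\le k\le n$, the image of the $k$-th row of $M$ under $s^+(v_1,\dots,v_n)=(0,v_1,\dots,v_{n-1})$ lies in the subgroup of $\mathbb{Z}^n$ generated by the rows $k+1,\dots,n$ of $M$; (5) the diagonal of $M$ is $(p^{d_1},\dots,p^{d_n})$. $F_n$ is the (non-unital) subring of $\mathbb{Z}[x]/(x^{n+1})$ generated by $x$, so $F_n=\mathbb{Z}x\oplus\dots\oplus\mathbb{Z}x^n$; it is a brace (abelian group $(F_n,+)$ with second group operation $a\circ b=a+ab+b$), and brace ideals and homomorphisms agree with ring ideals and homomorphisms. For a finite brace $A$ coming from such a commutative nilpotent ring, let $A^i$ denote the $i$-th power of the ring; $A$ is of type $(m_1,\dots,m_n)$ if $|A^i/A^{i+1}|=m_i$ for $1\le i\le n$ and $A^{n+1}=0$. For $M\in\mathcal{M}(p^{d_1},\dots,p^{d_n})$ let $I_M$ be the additive subgroup of $F_n$ generated by the elements $\sum_j m_jx^j$ with $(m_1,\dots,m_n)$ a row of $M$. The map $M\mapsto I_M$ is a bijection from $\mathcal{M}(p^{d_1},\dots,p^{d_n})$ onto the set of ideals $I$ of $F_n$ such that $F_n/I$ is of type $(p^{d_1},\dots,p^{d_n})$; each such ideal contains $p^dx$. Let $F_{n,p^d}=F_n/(p^dx)$, with $(p^dx)$ the ideal generated by $p^dx$,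 and denote the image of $x$ again by $x$. $\mathrm{Aut}(F_{n,p^d}^* )$ is the group of ring (equivalently brace) automorphisms $\phi$ of $F_{n,p^d}$ with $\phi(x+F_{n,p^d}^2)\subseteq x+F_{n,p^d}^2$. It acts on $\mathcal{M}(p^{d_1},\dots,p^{d_n})$: $\phi\cdot M$ is the unique matrix with $I_{\phi\cdot M}/(p^dx)=\phi(I_M/(p^dx))$. A solution is a pair $(X,r)$ with $X$ a nonempty set and $r:X^2\to X^2$ a bijection, $r(x,y)=(\sigma_x(y),\tau_y(x))$, satisfying the braid equation $(r\times \mathrm{id})(\mathrm{id}\times r)(r\times \mathrm{id})=(\mathrm{id}\times r)(r\times \mathrm{id})(\mathrm{id}\times r)$ with all $\sigma_x,\tau_x$ bijective. It is involutive if $r^2=\mathrm{id}$; indecomposable if the group generated by all $\sigma_x,\tau_x$ is transitive on $X$; its permutation group is $\langle(\sigma_x,\tau_x^{-1})\mid x\in X\rangle$. Isomorphisms are bijections $f$ with $(f\times f)r=s(f\times f)$. $\mathrm{Ret}(X,r)$ is the induced solution on $X/{\sim}$, where $x\sim y$ iff $\sigma_x=\sigma_y$ and $\tau_x=\tau_y$. $\mathbf{AbSol}(m_1,\dots,m_n)$ consists of the finite indecomposable involutive solutions $(X,r)$ with abelian permutation group such that $|\mathrm{Ret}^{i-1}(X,r)|/|\mathrm{Ret}^{i}(X,r)|=m_i$ for $1\le i\le n$ and $|\mathrm{Ret}^n(X,r)|=1$. *)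

(* Defs.v *)
From HB Require Import structures.
From mathcomp Require Import all_boot all_order all_fingroup all_algebra.
From mathcomp Require Import boolp classical_sets functions cardinality fsbigop.

Set Implicit Arguments.
Unset Strict Implicit.
Unset Printing Implicit Defensive.

Import Order.TTheory GRing.Theory Num.Theory.

(** * Solutions of the Yang-Baxter equation on finite sets *)

Record braiding := Braiding {
  carrier :> finType;
  bmap : carrier * carrier -> carrier * carrier }.

Section Solutions.
Local Open Scope quotient_scope.

Definition sigma (S : braiding) (x : S) : {ffun S -> S} :=
  [ffun y => (bmap (x, y)).1].

Definition tau (S : braiding) (y : S) : {ffun S -> S} :=
  [ffun x => (bmap (x, y)).2].

Definition bmap12 (S : braiding) (t : S * S * S) : S * S * S :=
  (bmap t.1, t.2).

Definition bmap23 (S : braiding) (t : S * S * S) : S * S * S :=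
  let u := bmap (t.1.2, t.2) in (t.1.1, u.1, u.2).

Definition is_solution (S : braiding) : Prop :=
  [/\ 0 < #|S|,
      bijective (@bmap S),
      (forall x : S, bijective (sigma x)),
      (forall x : S, bijective (tau x))
    & bmap12 (S := S) \o bmap23 (S := S) \o bmap12 (S := S)
      =1 bmap23 (S := S) \o bmap12 (S := S) \o bmap23 (S := S)].

(* [insubd] turns a bijective finite function into the corresponding
   permutation; its default value 1 is never used for a solution. *)
Definition sigma_perm (S : braiding) (x : S) : {perm S} :=
  insubd (1%g : {perm S}) (sigma x).

Definition tau_perm (S : braiding) (x : S) : {perm S} :=
  insubd (1%g : {perm S}) (tau x).

Definition indecomposable (S : braiding) : bool :=
  [transitive <<[set sigma_perm x | x : S] :|: [set tau_perm x | x : S]>>%g,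
     on [set: S] | 'P].

(* MathComp composes permutations from left to right, so this is the opposite
   of the group for the other convention; commutativity is not affected. *)
Definition permutation_group (S : braiding) :
    {group ({perm S} * {perm S})%type} :=
  <<[set (sigma_perm x, (tau_perm x)^-1%g) | x : S]>>%G.

Definition ret_rel (S : braiding) (x y : S) : bool :=
  (sigma x == sigma y) && (tau x == tau y).

Lemma ret_rel_equiv (S : braiding) : equiv_class_of (@ret_rel S).
Proof.
split=> [x|x y|y x z]; rewrite /ret_rel ?eqxx //.
- by rewrite eq_sym [tau x == _]eq_sym.
- by move=> /andP[/eqP-> /eqP->].
Qed.

Canonical ret_equiv (S : braiding) := EquivRelPack (ret_rel_equiv S).
Canonical ret_encModRel (S : braiding) := defaultEncModRel (@ret_rel S).

Definition ret_carrier (S : braiding) := {eq_quot (@ret_rel S)}.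

HB.instance Definition _ (S : braiding) :=
  [Finite of ret_carrier S by <:%/].
HB.instance Definition _ (S : braiding) := EqQuotient.on (ret_carrier S).

(* When S is a solution this does not depend on the representatives. *)
Definition ret_bmap (S : braiding) (u : ret_carrier S * ret_carrier S) :
    ret_carrier S * ret_carrier S :=
  let v := bmap (generic_quotient.repr u.1, generic_quotient.repr u.2) in
  (\pi_(ret_carrier S) v.1, \pi_(ret_carrier S) v.2).

Definition ret (S : braiding) : braiding := Braiding (@ret_bmap S).

(* The index i : 'I_n stands for i + 1 in the usual numbering of the m_i. *)
Definition AbSol (n : nat) (m : 'I_n -> nat) (S : braiding) : Prop :=
  [/\ is_solution S /\ involutive (@bmap S),
      indecomposable S,
      abelian (permutation_group S),
      (forall i : 'I_n, #|iter i ret S| = m i * #|iter i.+1 ret S|)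
    & #|iter n ret S| = 1].

Definition isomorphic (S T : braiding) : Prop :=
  exists2 f : S -> T, bijective f &
    forall x y : S, let v := bmap (x, y) in
      (f v.1, f v.2) = bmap (f x, f y).

(* C is the isomorphism class, inside P, of some element of P. *)
Definition iso_classes (P : braiding -> Prop) (C : braiding -> Prop) : Prop :=
  exists2 S, P S & C = (fun T => P T /\ isomorphic S T).

End Solutions.

(* The next two notions are [set_bij] and [card_eq] to [`I_n]; those of the
   library cannot be used for classes of braidings for universe reasons: the
   universe of [set] is below that of [finType]. *)
Definition bij_between (A B : Type) (P : A -> Prop) (Q : B -> Prop)
    (f : A -> B) : Prop :=
  [/\ (forall a, P a -> Q (f a)),
      (forall a a', P a -> P a' -> f a = f a' -> a = a')
    & (forall b, Q b -> exists2 a, P a & f a = b)].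

Definition has_card (A : Type) (P : A -> Prop) (n : nat) : Prop :=
  exists f : 'I_n -> A, bij_between (fun _ => True) P f.

(** * Matrices *)

Local Open Scope classical_set_scope.
Local Open Scope ring_scope.

Definition is_subgroup (V : zmodType) (A : set V) : Prop := zmod_closed (mem A).

Definition gen_subgroup (V : zmodType) (A : set V) : set V :=
  smallest (@is_subgroup V) A.

(* For j <> 0, the value of [ord_pred j] is j - 1. *)
Definition s_plus (n : nat) (v : 'rV[int]_n) : 'rV[int]_n :=
  \row_j (if j == 0%N :> nat then 0 else v ord0 (ord_pred j)).

Definition Mset (p n : nat) (d : 'I_n -> nat) : set 'M[int]_n :=
  [set M : 'M[int]_n | [/\ (forall i j : 'I_n, (j < i)%N -> M i j = 0),
               (forall i j : 'I_n, 0 <= M i j),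
               (forall i j : 'I_n, i != j -> M i j < M j j),
               (forall k : 'I_n,
                  gen_subgroup [set row i M | i in [set i : 'I_n | (k < i)%N]]
                    (s_plus (row k M)))
             & (forall i : 'I_n, M i i = (p ^ d i)%N%:Z)]].

(** * The non-unital ring F_n and its quotients *)

Section NonUnital.
Variables (V : zmodType) (mul : V -> V -> V).

Definition is_subrng (A : set V) : Prop :=
  is_subgroup A /\ (forall a b, A a -> A b -> A (mul a b)).

Definition is_ideal (J : set V) : Prop :=
  is_subgroup J /\ (forall a u, J u -> J (mul a u) /\ J (mul u a)).

Definition gen_ideal (A : set V) : set V := smallest is_ideal A.

Definition rng_square : set V :=
  gen_subgroup [set mul a b | a in [set: V] & b in [set: V]].

End NonUnital.

Lemma smallest_subgroup (V : zmodType) (C : set V -> Prop) (A : set V) :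
  (forall B, C B -> is_subgroup B) -> is_subgroup (smallest C A).
Proof.
move=> CP; split=> [|u v]; rewrite !inE.
  by move=> B [/CP[+ _] _]; rewrite inE.
move=> Au Av B CB; have [_ /(_ u v)] := CP _ CB.1.
by rewrite !inE; apply; [exact: Au | exact: Av].
Qed.

(* Z[x]/(x^(n+1)), with the class of x written 'qX. *)
Definition trunc_ring (n : nat) := {poly %/ ('X^(n.+1) : {poly int})}.
HB.instance Definition _ n := GRing.ComNzRing.on (trunc_ring n).

Definition Fset (n : nat) : set (trunc_ring n) :=
  smallest (is_subrng *%R) [set 'qX].

(* Boolean form of [Fset], needed to make F_n a subtype. *)
Definition Fpred (n : nat) : {pred trunc_ring n} := fun a => `[< Fset a >].

Lemma Fpred_zmod_closed n : zmod_closed (@Fpred n).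
Proof.
have [F0 FB] : is_subgroup (@Fset n) by apply: smallest_subgroup => B [].
split=> [|u v]; first by apply/asboolP; rewrite inE in F0.
by move=> /asboolP Fu /asboolP Fv; apply/asboolP; have := FB u v; rewrite !inE; apply.
Qed.

HB.instance Definition _ n :=
  GRing.isZmodClosed.Build (trunc_ring n) (@Fpred n) (@Fpred_zmod_closed n).

Record F (n : nat) := InF { F_val : trunc_ring n; _ : F_val \in @Fpred n }.

HB.instance Definition _ n := [isSub for @F_val n].
HB.instance Definition _ n := [Choice of F n by <:].
HB.instance Definition _ n := [SubChoice_isSubZmodule of F n by <:].

Lemma Fpred_mul n (a b : F n) : F_val a * F_val b \in @Fpred n.
Proof.
have Fa := valP a; have Fb := valP b; move: Fa Fb => /asboolP Fa /asboolP Fb.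
apply/asboolP => B CB; have [_ BM] := CB.1.
by apply: BM; [exact: Fa | exact: Fb].
Qed.

Lemma Fpred_X n : ('qX : trunc_ring n) \in @Fpred n.
Proof. by apply/asboolP => B [_]; apply. Qed.

Definition Fmul n (a b : F n) : F n := InF (Fpred_mul a b).

Definition Fx n : F n := InF (Fpred_X n).

Definition Fxpow n (k : nat) : F n := iter k (Fmul (Fx n)) (Fx n).

(* Column j (counted from 0) is the coefficient of x^(j+1) = [Fxpow n j]. *)
Definition Frow n (v : 'rV[int]_n) : F n := \sum_(j < n) Fxpow n j *~ v ord0 j.

Definition I_mx n (M : 'M[int]_n) : set (F n) :=
  gen_subgroup [set Frow (row i M) | i in [set: 'I_n]].

(* The ideal (N x) of F_n, as a boolean predicate. *)
Definition Fideal (n N : nat) : {pred F n} :=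
  fun a => `[< gen_ideal (@Fmul n) [set Fx n *+ N] a >].

Lemma Fideal_zmod_closed n N : zmod_closed (Fideal (n := n) N).
Proof.
have [F0 FB] : is_subgroup (gen_ideal (@Fmul n) [set Fx n *+ N]).
  by apply: smallest_subgroup => B [].
split=> [|u v]; first by apply/asboolP; rewrite inE in F0.
by move=> /asboolP Fu /asboolP Fv; apply/asboolP; have := FB u v; rewrite !inE; apply.
Qed.

HB.instance Definition _ n N :=
  GRing.isZmodClosed.Build (F n) (Fideal (n := n) N)
    (@Fideal_zmod_closed n N).

Definition Fmod (n N : nat) := Quotient.quot (Fideal (n := n) N).
HB.instance Definition _ n N := GRing.Zmodule.on (Fmod n N).

Local Open Scope quotient_scope.

Definition Fmod_mul n N (u v : Fmod n N) : Fmod n N :=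
  \pi_(Fmod n N) (Fmul (generic_quotient.repr u) (generic_quotient.repr v)).

Definition Fmod_x n N : Fmod n N := \pi_(Fmod n N) (Fx n).

Lemma Fmod_mulE n N (a b : F n) :
  Fmod_mul (\pi_(Fmod n N) a) (\pi_(Fmod n N) b) = \pi_(Fmod n N) (Fmul a b).
Proof.
have FidealM (c u : F n) : u \in Fideal N ->
    Fmul c u \in Fideal N /\ Fmul u c \in Fideal N.
  move=> /asboolP Ju; split; apply/asboolP => B CB;
    by have [_ /(_ c u (Ju B CB))[]] := CB.1.
have FmulBr (c u v : F n) : Fmul c (u - v) = Fmul c u - Fmul c v.
  by apply: val_inj; rewrite !raddfB /= mulrBr.
have FmulBl (c u v : F n) : Fmul (u - v) c = Fmul u c - Fmul v c.
  by apply: val_inj; rewrite !raddfB /= mulrBl.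
rewrite /Fmod_mul.
set a' := generic_quotient.repr _; set b' := generic_quotient.repr _.
have Ja : a' - a \in Fideal N by rewrite Quotient.idealrBE reprK.
have Jb : b' - b \in Fideal N by rewrite Quotient.idealrBE reprK.
apply/eqP; rewrite -Quotient.idealrBE.
rewrite -[Fmul a' b'](subrK (Fmul a' b)) -addrA -FmulBr -FmulBl.
by apply: rpredD; [exact: (FidealM _ _ Jb).1 | exact: (FidealM _ _ Ja).2].
Qed.

(* Only the underlying set of the group is needed, since only its orbits
   occur. *)
Definition AutF n N : set (Fmod n N -> Fmod n N) :=
  [set phi | [/\ bijective phi,
                 {morph phi : u v / u + v},
                 {morph phi : u v / Fmod_mul u v}
               & let coset := [set Fmod_x n N + w | w in
                                 rng_square (@Fmod_mul n N)] in
                 phi @` coset `<=` coset]].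

Definition I_mod n N (M : 'M[int]_n) : set (Fmod n N) :=
  [set \pi_(Fmod n N) a | a in I_mx M].
Arguments I_mod {n} N M.

(** * The action on matrices *)

Section Action.
Variables (p n : nat) (d : 'I_n -> nat).

Definition modulus : nat := (p ^ (\sum_i d i))%N.

(* The matrix in question exists and is unique for [phi] in [AutF n modulus] and
   [M] in [Mset p d]; the default value of [xget] is then irrelevant. *)
Definition act_mx (phi : Fmod n modulus -> Fmod n modulus) (M : 'M[int]_n) : 'M[int]_n :=
  xget M [set M' | Mset p d M' /\ I_mod modulus M' = phi @` I_mod modulus M].

Definition orbit_mx (M : 'M[int]_n) : set 'M[int]_n :=
  [set act_mx phi M | phi in @AutF n modulus].

Definition orbits : set (set 'M[int]_n) :=
  [set orbit_mx M | M in Mset p d].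

End Action.

(* Main.v *)
Require Import Defs.
From mathcomp Require Import all_boot all_order all_fingroup all_algebra finmap.
From mathcomp Require Import boolp classical_sets functions cardinality fsbigop.
From HB Require Import structures.
From Stdlib Require Import Ring.

(** Let G be the group generated by the sigma_x. It is abelian and transitive,
    hence regular, so a base point identifies S with G. The permutations
    t |-> t sigma(w / t) of G commute by the cycle set identity, and generate a
    second regular abelian group, normalized by the multiplications of G: this is
    the additive group of a ring A with G = 1 + A. Commutativity of G makes A a
    quotient of F_n, with sigma_u(v) = (1 + x u) v, as soon as the n-th retraction
    is trivial. Moreover the i-th retraction of S is the image of the i-th iterate
    of u |-> 1 + x u, so the sizes of the retractions are the indices of the
    A^(i+1), which are read off the diagonal of the Hermite normal form of the
    ideal. Finally, a change of base point replaces x by x w with w in 1 + F_n, so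
    two ideals give isomorphic solutions if and only if a substitution x |-> x w
    maps one to the other. *)

Set Implicit Arguments.
Unset Strict Implicit.
Unset Printing Implicit Defensive.
Import Order.TTheory GRing.Theory Num.Theory.

(** The ring A is never built as such. With 1 as base point [x0], [sp x0] is multiplication by 1 +
    x, so multiplication by x is its linear part minus the identity, and x itself is the additive
    coordinate of [sp x0 x0]. Every element of A is then x q(x) for an integer polynomial q, and the
    kernel J of this surjection from Z[X] carries all the information. When q stands for the unit 1
    + xq, verifications become identities in Z[X], up to cancelling factors 1 + X a, which are
    invertible modulo X^n. The obstacle is that transitivity and isomorphisms only speak of
    multiplications by 1 + xu with u a unit, whereas the conclusions concern all units 1 + xq.
    [circ_ind] bridges this gap. As for a new base point w: a unit u = w u' acts as 1 + xu = 1 +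
    (xw) u', which is why x becomes xw. *)

Local Notation sp := sigma_perm.

(** * Indecomposable involutive solutions with abelian permutation group *)

(** The working form of a solution, with the taus eliminated by involutivity: [ac_cycle] is the
    cycle set identity, [ac_diag] encodes the bijectivity of the taus, and [ac_ind] is transitivity
    as an induction principle that needs no inverses, S being finite. *)
Record abelian_cycle (S : braiding) : Prop := AbelianCycle {
  ac_bmap : forall x y : S, bmap (x, y) = (sp x y, (sp (sp x y))^-1%g x);
  ac_comm : forall x y z : S, sp x (sp y z) = sp y (sp x z);
  ac_cycle : forall x y z : S,
    sp x (sp ((sp x)^-1%g y) z) = sp y (sp ((sp y)^-1%g x) z);
  ac_diag : injective (fun x : S => (sp x)^-1%g x);
  ac_ind : forall (Q : S -> Prop) (x : S), Q x ->
    (forall v t : S, Q t -> Q (sp v t)) -> forall t, Q t }.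

(** On a finite set the inverse of [g] is a power of [g]. *)
Lemma perm_stable_inv (T : finType) (g : {perm T}) (Q : T -> Prop) :
  (forall t, Q t -> Q (g t)) -> forall t, Q t -> Q (g^-1%g t).
Proof.
move=> gQ t Qt; rewrite invg_expg permX.
by elim: #[g]%g.-1 => //= k; apply: gQ.
Qed.

Lemma gen_stable (T : finType) (A : {set {perm T}}) (Q : T -> Prop) :
  (forall g t, g \in A -> Q t -> Q (g t)) ->
  forall g t, g \in <<A>>%g -> Q t -> Q (g t).
Proof.
move=> AQ g t /gen_prodgP[k [c cA ->]].
elim: k c cA t => [|k IH] c cA t Qt; first by rewrite big_ord0 perm1.
by rewrite big_ord_recl permM; apply: IH => [i|]; [exact: cA | exact: AQ].
Qed.

Lemma sigma_permE (S : braiding) (x y : S) :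
  injective (sigma x) -> sp x y = (bmap (x, y)).1.
Proof.
move=> /injectiveP inj.
have := @insubdK _ _ {perm S} 1%g (sigma x) inj.
rewrite -/(sigma_perm x) => E.
by rewrite -[RHS](ffunE (fun y => (bmap (x, y)).1)) -/(sigma x) -E pvalE.
Qed.

Lemma tau_permE (S : braiding) (x y : S) :
  injective (tau x) -> tau_perm x y = (bmap (y, x)).2.
Proof.
move=> /injectiveP inj.
have := @insubdK _ _ {perm S} 1%g (tau x) inj.
rewrite -/(tau_perm x) => E.
by rewrite -[RHS](ffunE (fun y => (bmap (y, x)).2)) -/(tau x) -E pvalE.
Qed.

Definition abelian_solution (S : braiding) : Prop :=
  [/\ is_solution S, involutive (@bmap S), indecomposable S
    & abelian (permutation_group S)].

Section FromSolution.
Variable S : braiding.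
Hypothesis solS : abelian_solution S.

Lemma solution_sigmaE (x y : S) : sp x y = (bmap (x, y)).1.
Proof.
by have [[_ _ + _ _] _ _ _] := solS => /(_ x)/bij_inj; exact: sigma_permE.
Qed.

Lemma solution_tauE (x y : S) : tau_perm x y = (bmap (y, x)).2.
Proof.
by have [[_ _ _ + _] _ _ _] := solS => /(_ x)/bij_inj; exact: tau_permE.
Qed.

Lemma solution_bmapE (x y : S) : bmap (x, y) = (sp x y, (sp (sp x y))^-1%g x).
Proof.
have [_ /(_ (x, y)) inv _ _] := solS.
rewrite [LHS]surjective_pairing -solution_sigmaE; congr (_, _).
apply: (@perm_inj _ (sp (sp x y))); rewrite permKV.
by rewrite solution_sigmaE solution_sigmaE -surjective_pairing inv.
Qed.

Lemma solution_comm (x y z : S) : sp x (sp y z) = sp y (sp x z).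
Proof.
have [_ _ _ /centsP ab] := solS.
have gx (u : S) : (sp u, (tau_perm u)^-1%g) \in permutation_group S.
  by apply: mem_gen; apply: imset_f.
have [/(congr1 (fun g : {perm S} => g z))] := ab _ (gx x) _ (gx y).
by rewrite !permM.
Qed.

Lemma solution_braid (x y z : S) :
  sp x (sp y z) = sp (sp x y) (sp ((sp (sp x y))^-1%g x) z).
Proof.
have [[_ _ _ _ ybe] _ _ _] := solS; have := ybe (x, y, z).
by rewrite /bmap12 /bmap23 /= !solution_bmapE /=; case.
Qed.

Lemma solution_cycle (x y z : S) :
  sp x (sp ((sp x)^-1%g y) z) = sp y (sp ((sp y)^-1%g x) z).
Proof. by rewrite solution_braid permKV. Qed.

(** With z = (sp x)^-1 x, the pair (x, z) is fixed by [bmap]. So tau of z maps x to z, and its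
    injectivity recovers x from z. *)
Lemma solution_diag : injective (fun x : S => (sp x)^-1%g x).
Proof.
move=> x y /= E; apply: (@perm_inj _ (tau_perm ((sp x)^-1%g x))).
have fixd (z : S) : tau_perm ((sp z)^-1%g z) z = (sp z)^-1%g z.
  by rewrite solution_tauE solution_bmapE /= permKV.
by rewrite fixd E fixd.
Qed.

Lemma solution_ind (Q : S -> Prop) (x : S) : Q x ->
  (forall v t : S, Q t -> Q (sp v t)) -> forall t, Q t.
Proof.
move=> Qx Qs t; have [_ _ /atransP tr _] := solS.
have : t \in [set: S] by rewrite inE.
rewrite -(tr x) ?inE // => /orbitP[g Gg <-] /=.
apply: (gen_stable _ Gg Qx) => {Gg}g {}t /setUP[/imsetP[v _ ->]|/imsetP[v _ ->]] Qt.
  exact: Qs.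
rewrite solution_tauE solution_bmapE /=.
by apply: perm_stable_inv Qt => u; exact: Qs.
Qed.

Lemma solution_abelian_cycle : abelian_cycle S.
Proof.
split; [exact: solution_bmapE | exact: solution_comm | exact: solution_cycle
  | exact: solution_diag | exact: solution_ind].
Qed.

End FromSolution.

(** * From the cycle set back to a solution, and its retractions *)

Section CycleTheory.
Variable S : braiding.
Hypothesis acS : abelian_cycle S.

Let bE := ac_bmap acS.
Let cE := ac_comm acS.

Lemma cycle_braid (x y z : S) :
  sp x (sp y z) = sp (sp x y) (sp ((sp (sp x y))^-1%g x) z).
Proof. by have := ac_cycle acS x (sp x y) z; rewrite permK. Qed.

Lemma cycle_involutive : involutive (@bmap S).
Proof. by case=> x y; rewrite bE bE permKV permK. Qed.

(* The coordinates (x, sigma_x y, sigma_x sigma_y z) turn the two braidings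
   into transpositions. *)
Lemma cycle_ybe : bmap12 (S := S) \o bmap23 (S := S) \o bmap12 (S := S)
  =1 bmap23 (S := S) \o bmap12 (S := S) \o bmap23 (S := S).
Proof.
pose c (t : S * S * S) := (t.1.1, sp t.1.1 t.1.2, sp t.1.1 (sp t.1.2 t.2)).
have c_inj : injective c.
  by case=> [[x y] z] [[x' y'] z'] [<- /perm_inj <- /perm_inj/perm_inj <-].
have c12 t : c (bmap12 t) = ((c t).1.2, (c t).1.1, (c t).2).
  case: t => [[x y] z]; rewrite /bmap12 /c /= bE /= permKV.
  by rewrite -cycle_braid.
have c23 t : c (bmap23 t) = ((c t).1.1, (c t).2, (c t).1.2).
  by case: t => [[x y] z]; rewrite /bmap23 /c /= bE /= permKV.
by move=> t; apply: c_inj; rewrite /= !(c12, c23).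
Qed.

Let diag (x : S) := (sp x)^-1%g x.

(** The diagonal map conjugates taus into inverses of sigmas; [cycle_solution] uses this to carry
    injectivity and commutativity over to the taus. *)
Lemma cycle_diag_tau (x y : S) : diag (bmap (x, y)).2 = (sp y)^-1%g (diag x).
Proof.
rewrite bE /= /diag; set u := sp x y; set t := (sp u)^-1%g x.
apply: (@perm_inj _ (sp t)); rewrite permKV.
apply: (@perm_inj _ (sp u)); rewrite -/t /u -[in RHS]cycle_braid -/u permKV.
by rewrite permKV permKV.
Qed.

Lemma cycle_solution (x0 : S) : abelian_solution S.
Proof.
have sinj (x : S) : injective (sigma x).
  by move=> y z; rewrite !ffunE !bE /=; exact: perm_inj.
have tinj (x : S) : injective (tau x).
  move=> y z; rewrite !ffunE => E; apply: (ac_diag acS).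
  apply: (@perm_inj _ (sp x)^-1%g); rewrite -/(diag y) -/(diag z).
  by rewrite -!cycle_diag_tau E.
split.
- split.
  + by apply/card_gt0P; exists x0.
  + by exists (@bmap S); exact: cycle_involutive.
  + by move=> x; apply: injF_bij; exact: sinj.
  + by move=> x; apply: injF_bij; exact: tinj.
  + exact: cycle_ybe.
- exact: cycle_involutive.
- apply/imsetP; exists x0; first by rewrite inE.
  apply/esym/setP => t; rewrite inE.
  pose Q t := t \in orbit 'P <<[set sp x | x : S] :|: [set tau_perm x | x : S]>>%g x0.
  apply: (ac_ind acS (Q := Q) (x := x0)); first exact: orbit_refl.
  move=> v {}t /orbitP[g Gg <-]; apply/orbitP; exists (g * sp v)%g; last by rewrite actM.
  by apply: groupM => //; apply: mem_gen; apply/setUP; left; apply: imset_f.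
- rewrite abelian_gen; apply/centsP => _ /imsetP[x _ ->] _ /imsetP[y _ ->].
  rewrite /commute; congr (_, _); rewrite /=.
    by apply/permP => z; rewrite !permM cE.
  rewrite -!invMg; congr (_ ^-1)%g; apply/permP => z; rewrite !permM !tau_permE //.
  apply: (ac_diag acS); rewrite -/(diag _) -/(diag _) !cycle_diag_tau.
  apply: (@perm_inj _ (sp y)); rewrite permKV.
  apply: (@perm_inj _ (sp x)); rewrite permKV.
  by rewrite cE !permKV.
Qed.

(* [ret_eq i] is the kernel of the projection of S onto its i-th retraction. *)
Fixpoint ret_eq (i : nat) (x y : S) : Prop :=
  if i is j.+1 then forall z, ret_eq j (sp x z) (sp y z) else x = y.

Lemma ret_eq_sym i x y : ret_eq i x y -> ret_eq i y x.
Proof. by elim: i x y => [|i IH] x y //= H z; apply: IH. Qed.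

Lemma ret_eq_trans i x y z : ret_eq i x y -> ret_eq i y z -> ret_eq i x z.
Proof.
elim: i x y z => [|i IH] x y z /=; first by move=> -> ->.
by move=> H K t; apply: IH (H t) (K t).
Qed.

Lemma ret_eqS i x y : ret_eq i x y -> ret_eq i.+1 x y.
Proof.
elim: i x y => [|i IH] x y; first by move=> /= -> z.
by move=> H z; apply: IH; apply: H.
Qed.

(** The inverse comes first: the cycle identity expresses the sigma of (sp m)^-1 u through those of
    u and of (sp u)^-1 m. The direct image follows, [sp m] being a power of its inverse. *)
Lemma ret_eq_perm i m x y :
  ret_eq i x y -> ret_eq i (sp m x) (sp m y) /\ ret_eq i ((sp m)^-1%g x) ((sp m)^-1%g y).
Proof.
elim: i m x y => [|i IH] m x y; first by move=> ->.
move=> H.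
have Hinv m' x' y' : ret_eq i.+1 x' y' ->
    ret_eq i.+1 ((sp m')^-1%g x') ((sp m')^-1%g y').
  move=> {}H z.
  have E (u : S) : sp ((sp m')^-1%g u) z = (sp m')^-1%g (sp u (sp ((sp u)^-1%g m') z)).
    by rewrite -(ac_cycle acS) permK.
  rewrite !E; apply: (IH m' _ _ _).2.
  apply: ret_eq_trans (H _) _.
  rewrite !(cE y').
  have Hm : ret_eq i ((sp x')^-1%g m') ((sp y')^-1%g m').
    (* As sigmas commute, at this point the two sides of [H] are (sp y')^-1 m' and (sp x')^-1 m': a
       relation between sigmas becomes one between their inverses. *)
    have := H ((sp y')^-1%g ((sp x')^-1%g m')); rewrite permKV.
    have -> : sp x' ((sp y')^-1%g ((sp x')^-1%g m')) = (sp y')^-1%g m'.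
      by apply: (@perm_inj _ (sp y')); rewrite cE !permKV.
    exact: ret_eq_sym.
  exact: (ret_eqS Hm).
split; last exact: Hinv.
pose Q (u : S * S) := ret_eq i.+1 u.1 u.2.
rewrite -[sp m]invgK invg_expg !permX; elim: _.-1 => //= k Hk.
exact: Hinv.
Qed.

Lemma ret_proj i : exists q : S -> iter i ret S,
  [/\ forall z, exists x, q x = z,
      forall x y, q x = q y <-> ret_eq i x y
    & forall x y, bmap (q x, q y) = (q (bmap (x, y)).1, q (bmap (x, y)).2)].
Proof.
elim: i => [|i [q [qs qe qb]]].
  by exists id; split=> [z|//|x y]; [exists z | rewrite -surjective_pairing].
pose T := iter i ret S.
have retE x y : ret_rel (q x) (q y) <-> ret_eq i.+1 x y.
  split=> [/andP[/eqP sE _] z|H].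
    have := congr1 (fun f : {ffun T -> T} => f (q z)) sE.
    by rewrite !ffunE !qb /= !bE /= => /qe.
  apply/andP; split; apply/eqP/ffunP => w; have [z <-] := qs w.
    by rewrite !ffunE !qb !bE /=; apply/qe; apply: H.
  (* Agreement of the taus follows from that of the sigmas, again by testing at a point where both
     inverses appear. *)
  rewrite !ffunE !qb !bE /=; apply/qe.
  have := (ret_eq_perm z H).1 => /(_ ((sp (sp z x))^-1%g ((sp (sp z y))^-1%g z))).
  rewrite permKV.
  have -> : sp (sp z y) ((sp (sp z x))^-1%g ((sp (sp z y))^-1%g z)) = (sp (sp z x))^-1%g z.
    by apply: (@perm_inj _ (sp (sp z x))); rewrite cE !permKV.
  exact: ret_eq_sym.
have piE (u v : T) : (\pi_(ret_carrier T) u = \pi_(ret_carrier T) v)%qT <-> ret_rel u v.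
  exact: (rwP (@eqmodP _ (ret_equiv T) u v)).
exists (fun x => (\pi_(ret_carrier T) (q x))%qT); split.
- move=> z; have [x qx] := qs (generic_quotient.repr z); exists x.
  by rewrite qx reprK.
- by move=> x y; rewrite -retE piE.
move=> x y; rewrite /= /ret_bmap.
have repP (u : S) : exists2 u', generic_quotient.repr (\pi_(ret_carrier T) (q u))%qT = q u'
    & ret_eq i.+1 u' u.
  have [u' Eu] := qs (generic_quotient.repr (\pi_(ret_carrier T) (q u))%qT).
  by exists u' => //; apply/retE/piE; rewrite Eu reprK.
have [x' -> Hx] := repP x; have [y' -> Hy] := repP y.
rewrite qb !bE /=.
have Hxy : ret_eq i.+1 (sp x' y') (sp x y).
  apply: ret_eq_trans (ret_eq_perm x' Hy).1 _.
  exact: ret_eqS (Hx y).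
have pE u v : ret_eq i.+1 u v ->
    (\pi_(ret_carrier T) (q u) = \pi_(ret_carrier T) (q v))%qT.
  by move=> /retE/piE.
congr (_, _); apply: pE => //.
apply: ret_eq_trans (ret_eq_perm _ Hx).2 _.
apply: ret_eqS.
set u := sp x' y' in Hxy *; set v := sp x y in Hxy *.
have := Hxy ((sp u)^-1%g ((sp v)^-1%g x)); rewrite permKV.
have -> : sp v ((sp u)^-1%g ((sp v)^-1%g x)) = (sp u)^-1%g x.
  by apply: (@perm_inj _ (sp u)); rewrite cE !permKV.
exact: ret_eq_sym.
Qed.

(** Sigmas commute, so the relation at t passes to each [sp v t], and transitivity reaches every
    point. Testing at one base point is what turns retractions into images of an iterated
    self-map. *)
Lemma ret_eqSE (x0 : S) i x y : ret_eq i.+1 x y <-> ret_eq i (sp x x0) (sp y x0).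
Proof.
split=> [|H]; first exact.
apply: (ac_ind acS (x := x0)) => // v t Ht.
by rewrite !(cE _ v); apply: (ret_eq_perm v Ht).1.
Qed.

Lemma card_ret (x0 : S) i :
  #|iter i ret S| = #|[set iter i (fun x => sp x x0) x | x : S]|.
Proof.
have [q [qs qe _]] := ret_proj i.
have E x y : ret_eq i x y <-> iter i (fun x => sp x x0) x = iter i (fun x => sp x x0) y.
  elim: i x y {q qs qe} => [//|i IH] x y; rewrite (ret_eqSE x0) IH.
  by rewrite !iterSr.
pose r z := sval (cid (qs z)).
have qr z : q (r z) = z by exact: (svalP (cid (qs z))).
rewrite -cardsT -(card_imset _ (f := fun z => iter i (fun x => sp x x0) (r z))); last first.
  by move=> z z' /E/qe; rewrite !qr.
apply: eq_card => z; apply/imsetP/imsetP => [[w _ ->]|[x _ ->]].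
  by exists (r w).
by exists (q x) => //; apply/E/qe; rewrite qr.
Qed.

End CycleTheory.

(** * Ring identities in Z[X] *)

Local Open Scope ring_scope.

Local Notation P := {poly int}.
(* Stdlib's [ring] recognizes operations up to syntax only, whereas those of
   {poly int} are inferred through several canonical instances; [pring] first
   rewrites them all into the following constants. *)
Definition padd (a b : P) : P := a + b.
Definition pmul (a b : P) : P := a * b.
Definition popp (a : P) : P := - a.
Definition pone : P := 1.
Definition pzero : P := 0.
Definition pX : P := 'X.
Lemma pring_theory : ring_theory pzero pone padd pmul (fun a b => padd a (popp b)) popp eq.
Proof.
split; [exact: add0r | exact: addrC | exact: addrA | exact: mul1r | exact: mulrC
  | exact: mulrA | exact: mulrDl | by [] | exact: subrr].
Qed.
Add Ring poly_int_ring : pring_theory.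
Lemma pringE : (forall a b : P, a + b = padd a b) * (forall a b : P, a * b = pmul a b)
  * (forall a : P, - a = popp a) * ((1 : P) = pone) * ((0 : P) = pzero)
  * (('X : P) = pX).
Proof. by []. Qed.
Ltac pring := rewrite ?exprS ?expr0 ?pringE;
  match goal with |- @eq _ ?a ?b => change (@eq P a b); ring end.

(** * The additive structure of a solution *)

(* 1 + X (star a b) = (1 + X (1 + X a)) (1 + X b) *)
Definition star (a b : {poly int}) : {poly int} := b + (1 + 'X * a) * (1 + 'X * b).

(* The ideals J of Z[x] containing x^n correspond to the ideals xJ of F_n. *)
Record trunc_ideal (n : nat) (J : {poly int} -> Prop) : Prop := TruncIdeal {
  idealB : forall a b, J a -> J b -> J (a - b);
  idealM : forall a b, J b -> J (a * b);
  idealXn : J 'X^n }.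

(* Here q stands for the unit u = 1 + x q of Z[x]/(x^(n+1)): S is the quotient of
   1 + F_n by the units congruent to 1 modulo xJ, and sigma_u(v) = (1 + x u) v. *)
Record model (n : nat) (J : {poly int} -> Prop) (S : braiding)
    (pr : {poly int} -> S) : Prop := Model {
  model_ideal : trunc_ideal n J;
  model_surj : forall x, exists q, pr q = x;
  model_ker : forall q r, pr q = pr r <-> J (q - r);
  model_inv : involutive (@bmap S);
  model_star : forall q r, (bmap (pr q, pr r)).1 = pr (star q r) }.

(** A transitive abelian permutation group is regular, so the points inherit its group law, with
    [x0] as zero and A acting by translations. *)
Lemma regular_zmod (T : finType) (A : {group {perm T}}) (x0 : T) :
  abelian A -> (forall t, exists2 a, a \in A & a x0 = t) ->
  exists (V : zmodType) (f : T -> V),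
    [/\ bijective f, f x0 = 0 &
        forall a t, a \in A -> f (a t) = f t + f (a x0)].
Proof.
move=> /centsP abA trA.
have comm a b t : a \in A -> b \in A -> a (b t) = b (a t).
  by move=> aA bA; rewrite -!permM (abA _ aA).
pose a_ t : {perm T} := s2val (cid2 (trA t)).
have aA t : a_ t \in A by exact: s2valP (cid2 (trA t)).
have aE t : a_ t x0 = t by exact: s2valP' (cid2 (trA t)).
have aM a t : a \in A -> a t = a_ (a x0) t.
  by move=> aA'; rewrite -(aE t) !(comm _ (a_ t)) // aE.
have addC : commutative (fun s t => a_ s t).
  by move=> s t /=; rewrite -{1}(aE t) comm // aE.
have addA : associative (fun s t => a_ s t).
  move=> s t u /=; rewrite -permM aM ?groupM // permM aE.
  by rewrite addC.
have add0 : left_id x0 (fun s t => a_ s t).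
  by move=> t /=; rewrite addC aE.
have addN : left_inverse x0 (fun s => (a_ s)^-1%g x0) (fun s t => a_ s t).
  by move=> s /=; rewrite addC permKV.
pose V : zmodType := HB.pack (Finite.sort T) (GRing.isZmodule.Build T addA addC add0 addN).
exists V, id; split=> [|//|a t aA']; first by exists id.
by rewrite addrC aM.
Qed.

Definition sigma_group (S : braiding) : {group {perm S}} := <<[set sp x | x : S]>>%G.

Section Additive.
Variables (S : braiding) (x0 : S).
Hypothesis acS : abelian_cycle S.

Local Notation G := (sigma_group S).

Lemma mem_sigma_group (v : S) : sp v \in G.
Proof. by apply: mem_gen; exact: imset_f. Qed.
Local Hint Resolve mem_sigma_group : core.

Lemma sigma_group_comm g h t : g \in G -> h \in G -> g (h t) = h (g t).
Proof.
have /centsP abG : abelian G.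
  rewrite /sigma_group /= abelian_gen; apply/centsP => _ /imsetP[x _ ->] _ /imsetP[y _ ->].
  by apply/permP => z; rewrite !permM (ac_comm acS).
by move=> gG hG; rewrite -!permM (abG _ gG).
Qed.

Let Gtrans t : exists2 g, g \in G & g x0 = t.
Proof.
apply: (ac_ind acS (Q := fun t => exists2 g, g \in G & g x0 = t) (x := x0)) t.
  by exists 1%g; rewrite ?perm1.
move=> v t [g gG <-]; exists (g * sp v)%g; last by rewrite permM.
by rewrite groupM.
Qed.

Let Greg g h t : g \in G -> h \in G -> g t = h t -> g = h.
Proof.
move=> gG hG E; apply/permP => u.
have [k kG <-] := Gtrans u; have [k' k'G Et] := Gtrans t.
have E0 : g x0 = h x0.
  by apply: (@perm_inj _ k'); rewrite !(sigma_group_comm _ k'G) // Et.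
by rewrite !(sigma_group_comm _ _ kG) // E0.
Qed.

Let g_ t : {perm S} := s2val (cid2 (Gtrans t)).
Let gG t : g_ t \in G. Proof. exact: s2valP (cid2 (Gtrans t)). Qed.
Let gE t : g_ t x0 = t. Proof. exact: s2valP' (cid2 (Gtrans t)). Qed.
Let gM g t : g \in G -> g_ (g t) = (g_ t * g)%g.
Proof.
by move=> hG; apply: (@Greg _ _ x0); rewrite ?groupM // permM !gE.
Qed.

(* In terms of the units 1 + x q, [transl w] is the translation t |-> t + w x,
   and its commutation with [transl v] is the cycle set identity. *)
Let transl w t := sp ((g_ t)^-1%g w) t.

Let transl_comm v w t : transl v (transl w t) = transl w (transl v t).
Proof.
rewrite /transl !gM // !invMg !permM.
set a := (g_ t)^-1%g w; set b := (g_ t)^-1%g v.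
have E u z : (g_ t)^-1%g ((sp u)^-1%g z) = (sp u)^-1%g ((g_ t)^-1%g z).
  by rewrite sigma_group_comm ?groupV.
by rewrite !E -/a -/b [LHS](ac_comm acS) [RHS](ac_comm acS) (ac_cycle acS).
Qed.

(** Put a = (g_ t)^-1 w. The point [transl w t] determines (sp a)^-1 a, hence a by [ac_diag], hence
    [g_ t], which by regularity is the only element of G sending a to w. *)
Let transl_inj w : injective (transl w).
Proof.
move=> t t' E.
have Ea : (g_ t)^-1%g w = (g_ t')^-1%g w.
  apply: (ac_diag acS) => /=.
  have := congr1 (fun u => (g_ u)^-1%g w) E.
  by rewrite /transl !gM // !invMg !permM !(sigma_group_comm (g := (g_ _)^-1%g)) ?groupV.
have : g_ t = g_ t'.
  apply: (@Greg _ _ ((g_ t)^-1%g w)) => //.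
  by rewrite permKV Ea permKV.
by move=> /(congr1 (fun g : {perm S} => g x0)); rewrite !gE.
Qed.

Let tr w : {perm S} := perm (@transl_inj w).
Let A := <<[set tr w | w : S]>>%G.

Let g_x0 : g_ x0 = 1%g.
Proof. by apply: (@Greg _ _ x0) => //; rewrite ?gE ?perm1. Qed.

Let trA w : tr w \in A.
Proof. by apply: mem_gen; exact: imset_f. Qed.

(** Distributivity: multiplication by g conjugates the translation by w x into the translation by (g
    w) x. *)
Let A_normal g a : g \in G -> a \in A -> (a ^ g)%g \in A.
Proof.
move=> hG aA; rewrite -[A]/(<<_>>%G) /=.
have sub : <<[set tr w | w : S]>>%g \subset (<<[set tr w | w : S]>> :^ g^-1)%g.
  rewrite gen_subG; apply/fintype.subsetP => _ /imsetP[w _ ->].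
  rewrite mem_conjgV.
  suff -> : (tr w ^ g)%g = tr (g w) by exact: trA.
  apply/permP => t; rewrite -[t](permKV g) permJ !permE /transl gM //.
  set u := (g^-1)%g t; rewrite -sigma_group_comm // invMg permM.
  congr (sp _ _); rewrite sigma_group_comm ?groupV // sigma_group_comm ?groupV //.
  by rewrite permK.
by have := fintype.subsetP sub _ aA; rewrite mem_conjgV.
Qed.

Let A_trans t : exists2 a, a \in A & a x0 = t.
Proof.
apply: (ac_ind acS (Q := fun t => exists2 a, a \in A & a x0 = t) (x := x0)) t.
  by exists 1%g; rewrite ?perm1.
move=> v t [a aA <-]; exists (a * tr (g_ (a x0) v))%g; first by rewrite groupM.
by rewrite permM permE /transl permK.
Qed.

(** Here [f t] is the unit t minus 1. The third clause says that G acts by affine maps; the last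
    one, with g multiplication by t, is (1 + x v) t = t + x (t v). *)
Lemma additive_structure : exists (V : zmodType) (f : S -> V),
  [/\ bijective f, f x0 = 0,
      (forall g s t z, g \in G -> f z = f s + f t ->
         f (g z) + f (g x0) = f (g s) + f (g t))
    & (forall v t, exists2 g, g \in G & t = g x0 /\ f (sp v t) = f t + f (sp (g v) x0))].
Proof.
have [||V [f [fb f0 fA]]] := @regular_zmod S A x0.
- rewrite abelian_gen; apply/centsP => _ /imsetP[x _ ->] _ /imsetP[y _ ->].
  by apply/permP => z; rewrite !permM !permE transl_comm.
- exact: A_trans.
exists V, f; split=> // [g s t z hG fz|v t].
  have [a aA Ea] := A_trans t.
  have -> : z = a s by apply: (bij_inj fb); rewrite fA // Ea.
  rewrite -Ea -(permJ a g s) -(permJ a g x0).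
  by rewrite (fA _ (g s)) ?(fA _ (g x0)) ?A_normal // -addrA [X in _ + X]addrC.
exists (g_ t) => //; split; first by rewrite gE.
have := fA (tr (g_ t v)) t (trA _).
by rewrite !permE /transl permK g_x0 invg1 perm1.
Qed.
End Additive.

Section Evaluation.
Variables (V : zmodType) (y : {additive V -> V}) (e : V).

(* q(y) applied to e *)
Definition ev (q : {poly int}) : V := \sum_(i < size q) iter i y e *~ q`_i.

Lemma ev_widen N (q : {poly int}) : (size q <= N)%N ->
  ev q = \sum_(i < N) iter i y e *~ q`_i.
Proof.
move=> le; rewrite /ev (big_ord_widen N (fun i => iter i y e *~ q`_i)) // big_mkcond.
by apply: eq_bigr => i _; case: ltnP => // ge; rewrite nth_default.
Qed.

Lemma evD (q r : {poly int}) : ev (q + r) = ev q + ev r.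
Proof.
pose N := maxn (size q) (size r).
rewrite (@ev_widen N q) ?leq_maxl // (@ev_widen N r) ?leq_maxr //.
rewrite (@ev_widen N) ?size_polyD // -big_split /=.
by apply: eq_bigr => i _; rewrite coefD mulrzDr.
Qed.

Lemma ev0 : ev 0 = 0.
Proof. by rewrite /ev size_poly0 big_ord0. Qed.

Lemma evN (q : {poly int}) : ev (- q) = - ev q.
Proof. by apply/eqP; rewrite -addr_eq0 -evD addNr ev0. Qed.

Fact ev_is_zmod_morphism : zmod_morphism ev.
Proof. by move=> q r; rewrite evD evN. Qed.

HB.instance Definition _ :=
  GRing.isZmodMorphism.Build {poly int} V ev ev_is_zmod_morphism.

Lemma evCM (c : int) (q : {poly int}) : ev (c%:P * q) = ev q *~ c.
Proof. by rewrite -raddfMz -mulrzl -[c in LHS]intz rmorph_int. Qed.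

Lemma evC (c : int) : ev c%:P = e *~ c.
Proof. by rewrite (@ev_widen 1) ?size_polyC_leq1 // big_ord1 coefC. Qed.

Lemma evXM (q : {poly int}) : ev ('X * q) = y (ev q).
Proof.
rewrite (@ev_widen (size q).+1); last first.
  by rewrite mulrC; apply: leq_trans (size_polyMleq _ _) _; rewrite size_polyX addn2.
rewrite big_ord_recl coefXM mulr0z add0r raddf_sum; apply: eq_bigr => i _.
by rewrite coefXM /= raddfMz.
Qed.

Lemma evXnM k (q : {poly int}) : ev ('X^k * q) = iter k y (ev q).
Proof. by elim: k => [|k IH]; rewrite ?expr0 ?mul1r // exprS -mulrA evXM IH. Qed.

Lemma iter_raddfD k u v : iter k y (u + v) = iter k y u + iter k y v.
Proof. by elim: k => //= k ->; rewrite raddfD. Qed.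

End Evaluation.

Lemma polyX_ind (K : {poly int} -> Prop) :
  K 0 -> (forall q c, K q -> K ('X * q + c%:P)) -> forall q, K q.
Proof. by move=> K0 KX; apply: poly_ind => // q c; rewrite mulrC; exact: KX. Qed.

Theorem model_of_cycle (S : braiding) (x0 : S) (n : nat) : abelian_cycle S ->
  (forall x y, iter n (fun x => sp x x0) x = iter n (fun x => sp x x0) y) ->
  exists J (pr : {poly int} -> S), model n J pr.
Proof.
move=> acS sconst.
have [V [f [[fi fK fiK] f0 fA fT]]] := additive_structure x0 acS.
pose G := sigma_group S.
have spG v : sp v \in G by exact: mem_sigma_group.
have Gcomm g h t : g \in G -> h \in G -> g (h t) = h (g t) by exact: sigma_group_comm.
(* The linear part of the affine map [h]: multiplication by the unit [h x0] when h is in G. *)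
pose B (h : {perm S}) u := f (h (fi u)) - f (h x0).
have BB h k u : h \in G -> B h (B k u) = f (h (k (fi u))) - f (h (k x0)).
  move=> hG; have := fA h (fi (B k u)) (k x0) (k (fi u)) hG.
  rewrite fiK subrK => /(_ erefl) E; rewrite {1}/B.
  by apply/eqP; rewrite subr_eq addrAC E addrK.
have BD h : h \in G -> zmod_morphism (B h).
  move=> hG u v; have := fA h (fi (u - v)) (fi v) (fi u) hG.
  rewrite !fiK subrK => /(_ erefl) E; rewrite /B opprB addrA subrK.
  by apply/eqP; rewrite subr_eq addrAC eq_sym subr_eq E.
(* As [sp x0] is multiplication by 1 + x, this is x, and [y] below is multiplication by x. Hence
   [ev y e q] is x q(x). *)
pose e := f (sp x0 x0).
have yD : zmod_morphism (fun u => B (sp x0) u - u).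
  by move=> u v; rewrite (BD _ (spG x0)) !opprD !opprK addrACA.
have [y yE] : exists y : {additive V -> V}, forall u, y u = B (sp x0) u - u.
  pose y : {additive V -> V} := HB.pack (fun u => B (sp x0) u - u)
    (GRing.isZmodMorphism.Build V V _ yD).
  by exists y.
have s_e t : f (sp t x0) = e + y (f t).
  have [g gG [Et]] := fT x0 t; rewrite -Et => E.
  have -> : f (sp t x0) = f (sp x0 t) - f t by rewrite E addrC addKr.
  by rewrite yE /B fK -/e [in RHS]addrA [e + _]addrC subrK.
have s_gen v t : exists2 g, g \in G & t = g x0 /\ f (sp v t) = f t + (e + y (f (g v))).
  by have [g gG [Et E]] := fT v t; exists g => //; split; rewrite // -s_e.
have Be g : g \in G -> B g e = e + y (f (g x0)).
  by move=> gG; rewrite /B {1}/e fK Gcomm // yE /B fK -/e [in RHS]addrA [e + _]addrC subrK.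
have By g u : g \in G -> B g (y u) = y (B g u).
  by move=> gG; rewrite !yE (BD _ gG) !BB // !(Gcomm g (sp x0)).
have Bev g r : g \in G -> f (g x0) = ev y e r ->
    forall q, B g (ev y e q) = ev y e (q + 'X * q * r).
  move=> gG Er; pose Bg : {additive V -> V} := HB.pack (B g)
    (GRing.isZmodMorphism.Build V V _ (BD _ gG)).
  have BgD : {morph B g : u v / u + v} by exact: (raddfD Bg).
  have BgZ c : {morph B g : u / u *~ c} by exact: (raddfMz Bg c).
  elim/polyX_ind => [|q c IH].
    by rewrite mulr0 mul0r addr0 ev0; exact: (raddf0 Bg).
  have -> : 'X * q + c%:P + 'X * ('X * q + c%:P) * r =
      'X * (q + 'X * q * r) + (c%:P + 'X * (c%:P * r)) by pring.
  rewrite !evD !evC !evXM BgD BgZ By // IH Be // Er.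
  by rewrite evCM raddfMz mulrzDl.
pose pr q := fi (ev y e q).
(* This is A = Z x + x A. Iterating it leaves a remainder in x^k A, which vanishes at k = n. *)
have e_gen u : exists (c : int) v, u = e *~ c + y v.
  rewrite -[u]fiK; move: (fi u).
  apply: (ac_ind acS (Q := fun t => exists (c : int) v, f t = e *~ c + y v) (x := x0)).
    by exists 0, 0; rewrite mulr0z raddf0 addr0.
  move=> v t [c [w Et]]; have [g gG [_ ->]] := s_gen v t.
  exists (c + 1), (w + f (g v)); rewrite Et mulrzDr mulr1z raddfD.
  by rewrite addrACA.
have e_genk k u : exists q v, u = ev y e q + iter k y v.
  elim: k => [|k [q [v ->]]]; first by exists 0, u; rewrite ev0 add0r.
  have [c [w ->]] := e_gen v; exists (q + 'X^k * c%:P), w.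
  rewrite evD evXnM evC -addrA; congr (_ + _).
  by rewrite iterSr iter_raddfD.
(* The self-map t |-> sp t x0 is affine with linear part [y], so y^n measures how far its n-th
   iterate is from being constant. *)
have yn u : iter n y u = 0.
  have E k t : f (iter k (fun x => sp x x0) t) - f (iter k (fun x => sp x x0) x0) = iter k y (f t).
    elim: k => [|k IH]; first by rewrite f0 subr0.
    by rewrite !iterS !s_e opprD addrACA subrr add0r -raddfB IH.
  by rewrite -[u]fiK -E (sconst _ x0) subrr.
have ev_surj u : exists q, ev y e q = u.
  by have [q [v ->]] := e_genk n u; exists q; rewrite yn addr0.
exists (fun q => ev y e q = 0), pr; split.
- split=> [a b Ja Jb|a b Jb|]; first by rewrite evD evN Ja Jb subr0.
    elim/polyX_ind: a => [|a c IH]; first by rewrite mul0r ev0.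
    rewrite mulrDl -mulrA evD evXM IH raddf0 add0r.
    by rewrite evCM Jb mul0rz.
  by rewrite -[X in ev _ _ X]mulr1 evXnM yn.
- move=> x; have [q Eq] := ev_surj (f x); exists q.
  by rewrite /pr Eq fK.
- move=> q r; rewrite /pr evD evN; split=> [/(can_inj fiK) ->|/eqP].
    by rewrite subrr.
  by rewrite subr_eq0 => /eqP->.
- exact: cycle_involutive.
move=> q r; rewrite (ac_bmap acS) /=; apply: (can_inj fK).
have [g gG [Er ->]] := s_gen (pr q) (pr r).
have := Bev g r gG; rewrite -Er {1}/pr fiK => /(_ erefl q).
rewrite /B -Er fiK => /(canRL (subrK _)) ->.
rewrite /pr !fiK.
have -> : star q r = r + (1%:P + 'X * (q + 'X * q * r + r)).
  by rewrite /star polyC1; pring.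
by rewrite !evD evC evXM !evD.
Qed.

(** * Solutions as quotients of Z[X] *)

(* 1 + X (circ a b) = (1 + X a) (1 + X b) *)
Definition circ (a b : {poly int}) : {poly int} := a + b + 'X * a * b.

Lemma one_addX_inv n (a : {poly int}) :
  exists b c : {poly int}, (1 + 'X * a) * b = 1 + 'X^n * c.
Proof.
elim: n => [|n [b [c E]]]; first by exists 0, (-1); rewrite mulr0 mul1r subrr.
exists (b - 'X^n * c), (- a * c).
by rewrite mulrBr E exprS; pring.
Qed.

Lemma poly_coef0_split (q : {poly int}) : exists q' : {poly int}, q = (q`_0)%:P + 'X * q'.
Proof.
exists (\poly_(i < (size q).-1) q`_i.+1).
apply/polyP => i; rewrite coefD coefC coefXM; case: i => [|i] /=; first by rewrite addr0.
rewrite add0r coef_poly; case: ltnP => // le.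
by rewrite nth_default // -ltnS; case: (size q) le.
Qed.

Lemma circA (a b c : {poly int}) : circ (circ a b) c = circ a (circ b c).
Proof. by rewrite /circ; pring. Qed.

(** In terms of units: a subgroup of 1 + F_n that contains 1 + xu along with each u is everything.
    The approximation is X-adic. A target a with constant coefficient 1 is 1 + X a', and
    approximating a' to order k approximates a to order k + 1. Other targets are reduced to this
    case by multiplying or dividing the unit by 1 + X, which shifts the constant coefficient of a by
    one. *)
Lemma circ_ind n (E : {poly int} -> Prop) :
  E 0 -> (forall a b, E a -> E b -> E (circ a b)) ->
  (forall a b, E a -> E (circ a b) -> E b) ->
  (forall a (c : {poly int}), E a -> E (a + 'X^n * c)) ->
  (forall v, E v -> E (1 + 'X * v)) -> forall a, E a.
Proof.
move=> E0 Ecirc Ediv En Estep.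
have E1 : E 1 by rewrite -[1]addr0 -(mulr0 'X); exact: Estep.
suff approx k (a : {poly int}) : exists b, E b /\ exists c : {poly int}, a - b = 'X^k * c.
  move=> a; have [b [Eb [c /(canRL (subrK _))->]]] := approx n a.
  by rewrite addrC; exact: En.
elim: k a => [|k IH] a; first by exists 0; split=> //; exists a; rewrite mul1r subr0.
suff approx0 (m : int) : forall a : {poly int}, a`_0 = m + 1 ->
    exists b, E b /\ exists c : {poly int}, a - b = 'X^(k.+1) * c.
  by apply: (approx0 (a`_0 - 1)); rewrite subrK.
elim/int_ind: m => [|m IHm|m IHm] {}a a0.
- have [a' Ea] := poly_coef0_split a; have [b [Eb [c Ec]]] := IH a'.
  exists (1 + 'X * b); split; first exact: Estep.
  by exists c; rewrite Ea a0 add0r polyC1 exprS -mulrA -Ec; pring.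
(* With v an approximate inverse of 1 + X, (a - 1) v represents the quotient of 1 + X a by 1 + X. *)
- have [v [c0 Ev]] := one_addX_inv k.+1 1.
  have v0 : v`_0 = 1.
    have := congr1 (fun p : {poly int} => p`_0) Ev.
    by rewrite mulr1 mulrDl mul1r !coefD coef1 coefXM coefXnM /= !addr0.
  have [|b [Eb [c Ec]]] := IHm ((a - 1) * v).
    by rewrite coef0M coefB a0 coef1 v0 mulr1 addrK -addn1 PoszD.
  exists (circ 1 b); split; first exact: Ecirc.
  exists ((1 + 'X) * c - (a - 1) * c0).
  have -> : 'X^(k.+1) * ((1 + 'X) * c - (a - 1) * c0)
    = (1 + 'X) * ('X^(k.+1) * c) - (a - 1) * (1 + 'X^(k.+1) * c0 - 1) by set u := 'X^_; pring.
  by rewrite -Ec -Ev /circ; pring.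
(* Order n is needed to apply [En] to the quotient, order k + 1 for the approximation; n + k + 1
   covers both. *)
- have [v [c0 Ev]] := one_addX_inv (n + k.+1) 1.
  have [|b' [Eb [c Ec]]] := IHm (circ 1 a).
    rewrite /circ mulr1 !coefD coef1 coefXM a0 /= addr0.
    by rewrite intS opprD !addrA subrr add0r.
  exists ((b' - 1) * v); split.
    apply: (Ediv 1) => //.
    have -> : circ 1 ((b' - 1) * v) = b' + 'X^n * ((b' - 1) * 'X^(k.+1) * c0).
      have -> : b' + 'X^n * ((b' - 1) * 'X^(k.+1) * c0) = 1 + (b' - 1) * (1 + 'X^(n + k.+1) * c0).
        by rewrite exprD; set u := 'X^n; set w := 'X^_; pring.
      by rewrite -Ev /circ; pring.
    exact: En.
  exists (c * v - 'X^n * c0 * a).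
  have -> : b' = circ 1 a - 'X^(k.+1) * c by rewrite -Ec; pring.
  have -> : 'X^(k.+1) * (c * v - 'X^n * c0 * a) =
      'X^(k.+1) * c * v - (1 + 'X^(n + k.+1) * c0 - 1) * a.
    by rewrite exprD; set u := 'X^n; set w := 'X^_; pring.
  by rewrite -Ev /circ; set w := 'X^_; pring.
Qed.

Section Ideal.
Variables (n : nat) (J : {poly int} -> Prop).
Hypothesis idJ : trunc_ideal n J.

Lemma ideal0 : J 0.
Proof. by rewrite -(mul0r 'X^n); apply: (idealM idJ); exact: (idealXn idJ). Qed.

Lemma idealN a : J a -> J (- a).
Proof. by move=> Ja; rewrite -[- a]mulN1r; exact: (idealM idJ). Qed.

Lemma idealD (a b : {poly int}) : J a -> J b -> J (a + b).
Proof. by move=> Ja Jb; rewrite -[b]opprK; apply: (idealB idJ) => //; exact: idealN. Qed.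

Lemma idealMr a b : J a -> J (a * b).
Proof. by rewrite mulrC; exact: (idealM idJ). Qed.

Lemma idealXnM a : J ('X^n * a).
Proof. by apply: idealMr; exact: (idealXn idJ). Qed.

Lemma idealB_sym (a b : {poly int}) : J (a - b) -> J (b - a).
Proof. by rewrite -[b - a]opprB; exact: idealN. Qed.

Lemma idealB_trans (b a c : {poly int}) : J (a - b) -> J (b - c) -> J (a - c).
Proof. by move=> Jab Jbc; rewrite -[a](subrK b) -addrA; exact: idealD. Qed.

Lemma ideal_unit (a b : {poly int}) : J ((1 + 'X * a) * b) -> J b.
Proof.
move=> Jb; have [v [c E]] := one_addX_inv n a.
have -> : b = v * ((1 + 'X * a) * b) - 'X^n * (c * b).
  have -> : v * ((1 + 'X * a) * b) = ((1 + 'X * a) * v) * b by pring.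
  by rewrite E; set u := 'X^n; pring.
by apply: (idealB idJ); [exact: (idealM idJ) | exact: idealXnM].
Qed.

End Ideal.

Lemma starB (a b c : {poly int}) : star a b - star a c = (1 + 'X * (1 + 'X * a)) * (b - c).
Proof. by rewrite /star; pring. Qed.

Lemma star_circ (a b : {poly int}) : star a b = circ (1 + 'X * a) b.
Proof. by rewrite /star /circ; pring. Qed.

(** * The solution of an ideal: transitivity and sizes of retractions *)

Section ModelCycle.
Variables (n : nat) (J : {poly int} -> Prop) (S : braiding) (pr : {poly int} -> S).
Hypothesis M : model n J pr.

Let idJ := model_ideal M.

Lemma model_spE q r : sp (pr q) (pr r) = pr (star q r).
Proof.
rewrite sigma_permE ?(model_star M) // => x y.
have [[b <-] [c <-]] := (model_surj M x, model_surj M y).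
rewrite !ffunE !(model_star M) => /(model_ker M).
by rewrite starB => /(ideal_unit idJ)/(model_ker M).
Qed.

Lemma model_bmapE (x y : S) : bmap (x, y) = (sp x y, (sp (sp x y))^-1%g x).
Proof.
have spE (u v : S) : sp u v = (bmap (u, v)).1.
  have [[b <-] [c <-]] := (model_surj M u, model_surj M v).
  by rewrite model_spE (model_star M).
rewrite [LHS]surjective_pairing -spE; congr (_, _).
apply: (@perm_inj _ (sp (sp x y))); rewrite permKV.
by rewrite !spE -surjective_pairing (model_inv M).
Qed.

Lemma model_cycle : abelian_cycle S.
Proof.
have spV (q r : {poly int}) : exists2 u, (sp (pr q))^-1%g (pr r) = pr u & J (star q u - r).
  have [u Eu] := model_surj M ((sp (pr q))^-1%g (pr r)).
  by exists u => //; apply/(model_ker M); rewrite -model_spE Eu permKV.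
split; first exact: model_bmapE.
- move=> x y z; have [[a <-] [b <-]] := (model_surj M x, model_surj M y).
  have [c <-] := model_surj M z.
  by rewrite !model_spE; congr (pr _); rewrite /star; pring.
- move=> x y z; have [[q <-] [r <-]] := (model_surj M x, model_surj M y).
  have [c <-] := model_surj M z.
  have [u -> Ju] := spV q r; have [v -> Jv] := spV r q.
  rewrite !model_spE; apply/(model_ker M).
  have -> : star q (star u c) - star r (star v c) =
     ('X * (1 + 'X * c)) * ((star q u - r) - (star r v - q)) by rewrite /star; pring.
  by apply: (idealM idJ); apply: (idealB idJ).
- move=> x y /=; have [[q <-] [r <-]] := (model_surj M x, model_surj M y).
  have [u -> Ju] := spV q q; have [v -> Jv] := spV r r.
  move=> /(model_ker M) Juv; apply/(model_ker M).
  (* For the units U of q and V of u, star q u = q reads (1 + X U) V = U, that is U (1 - X V) = V.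
     So V determines U, as 1 - X V is invertible. *)
  apply: (ideal_unit idJ (a := - (1 + 'X * v))).
  have -> : (1 + 'X * - (1 + 'X * v)) * (q - r) =
      (star r v - r) - (star q u - q) + (1 + 'X * (1 + 'X * q)) * (u - v).
    by rewrite /star; pring.
  by apply: (idealD idJ); [exact: (idealB idJ) | exact: (idealM idJ)].
move=> Q x; have [q0 <-] := model_surj M x => Q0 Qs t; have [r <-] := model_surj M t.
(* The units whose multiplication preserves and reflects [Q]; the equivalence makes them closed
   under division, as [circ_ind] requires. *)
pose E (a : {poly int}) := forall s : {poly int}, Q (pr s) <-> Q (pr (circ a s)).
have Estep v : E (1 + 'X * v).
  move=> s; rewrite -star_circ -model_spE; split; first exact: Qs.
  rewrite -{2}[pr s](permK (sp (pr v))).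
  by apply: perm_stable_inv => w; exact: Qs.
have Eall a : E a.
  apply: (circ_ind (n := n) (E := E)) => [s|{}a b Ea Eb s|{}a b Ea Eab s|{}a c Ea s|v _].
  - by have -> : circ 0 s = s by rewrite /circ; pring.
  - by rewrite circA -(Ea _) -(Eb _).
  - by rewrite (Ea (circ b s)) -circA.
  - rewrite (Ea s); suff -> : pr (circ (a + 'X^n * c) s) = pr (circ a s) by [].
    apply/(model_ker M).
    have -> : circ (a + 'X^n * c) s - circ a s = 'X^n * (c + 'X * c * s).
      by rewrite /circ; set u := 'X^n; pring.
    exact: (idealXnM idJ).
  - exact: Estep.
(* (r - q0) v represents the quotient of the units of r and q0. *)
have [v [c Ev]] := one_addX_inv n q0.
suff -> : pr r = pr (circ ((r - q0) * v) q0) by exact: (Eall _ q0).1.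
apply/(model_ker M).
have -> : r - circ ((r - q0) * v) q0 = (r - q0) * (1 - (1 + 'X * q0) * v).
  by rewrite /circ; pring.
have -> : (r - q0) * (1 - (1 + 'X * q0) * v) = 'X^n * - ((r - q0) * c).
  by rewrite Ev; set u := 'X^n; pring.
exact: (idealXnM idJ).
Qed.

(** [c j] generates the ideal of the coefficients of X^j in the elements of J divisible by X^j. For
    A = F_n/xJ it is thus the order of A^(j+1)/A^(j+2). *)
Definition lead_type (c : 'I_n -> nat) : Prop :=
  forall j : 'I_n, [/\ (0 < c j)%N, exists2 r : {poly int}, J ('X^j * r) & r`_0 = c j
    & forall r : {poly int}, J ('X^j * r) -> (c j %| r`_0)%Z].

Let s (x : S) := sp x (pr 0).
Let geo i : {poly int} := \sum_(k < i) 'X^k.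

Lemma model_iter i q : iter i s (pr q) = pr (geo i + 'X^i * q).
Proof.
elim: i q => [|i IH] q; first by rewrite /geo big_ord0 add0r mul1r.
rewrite iterSr /s model_spE IH; congr (pr _).
rewrite /geo big_ord_recr /= /star mulr0 addr0 mulr1 add0r mulrDr mulr1 addrA.
by rewrite exprSr mulrA.
Qed.

(** By [model_iter], the i-th image is a coset of the multiples of X^i. Division by [c i] splits it
    into translates of the next image by k X^i, with 0 <= k < c i. *)
Lemma card_model_ret_step c (i : 'I_n) : lead_type c ->
  #|iter i ret S| = (c i * #|iter i.+1 ret S|)%N.
Proof.
move=> /(_ i) [c_gt0 [w Jw w0] cdvd].
rewrite !(card_ret model_cycle (pr 0)).
set A := [set iter i _ x | x : S]%SET; set B := [set iter i.+1 _ x | x : S]%SET.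
pose rep x : {poly int} := sval (cid (model_surj M x)).
have repK x : pr (rep x) = x by exact: svalP (cid (model_surj M x)).
have repJ q : J (rep (pr q) - q) by apply/(model_ker M); rewrite repK.
have inB x : reflect (exists q, x = pr (geo i.+1 + 'X^(i.+1) * q)) (x \in B).
  apply: (iffP imsetP) => [[y _ ->]|[q ->]].
    by have [q <-] := model_surj M y; exists q; rewrite model_iter.
  by exists (pr q) => //; rewrite model_iter.
have inA x : reflect (exists q, x = pr (geo i + 'X^i * q)) (x \in A).
  apply: (iffP imsetP) => [[y _ ->]|[q ->]].
    by have [q <-] := model_surj M y; exists q; rewrite model_iter.
  by exists (pr q) => //; rewrite model_iter.
pose h (u : 'I_(c i) * S) := pr ((u.1)%:Z%:P * 'X^i + rep u.2).
have hE (k : 'I_(c i)) q : h (k, pr (geo i.+1 + 'X^(i.+1) * q)) =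
    pr (geo i + 'X^i * (1 + (k : int)%:P + 'X * q)).
  apply/(model_ker M); rewrite /= -[X in J X](subrK (rep (pr (geo i.+1 + 'X^(i.+1) * q)) -
     (geo i.+1 + 'X^(i.+1) * q))).
  apply: (idealD idJ) (repJ _).
  set v := rep _; rewrite /geo big_ord_recr /= exprS; set g := \sum_(_ < _) _.
  set X := 'X^i; set kk := _%:P.
  have J0 (z : {poly int}) : z = 0 -> J z by move=> ->; exact: (ideal0 idJ).
  by apply: J0; pring.
rewrite -[c i]card_ord -[#|'I_(c i)|]cardsT -cardsX.
rewrite -(card_in_imset (f := h)).
  apply: eq_card => x; apply/inA/imsetP.
    move=> [q ->]; have [q' Eq] := poly_coef0_split q.
    have ci0 : (c i)%:Z != 0 by case: (c i) c_gt0.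
    (* [geo i.+1] already contains one X^i, hence the shift by 1. *)
    pose m := q`_0 - 1; pose k := (m %% c i)%Z.
    have k0 : 0 <= k by exact: modz_ge0.
    have kl : (`|k| < c i)%N by rewrite -ltz_nat gez0_abs // ltz_pmod.
    have [w' Ew] := poly_coef0_split w.
    exists (Ordinal kl, pr (geo i.+1 + 'X^(i.+1) * (q' - (m %/ c i)%Z%:P * w'))).
      by rewrite !inE /=; apply/inB; exists (q' - (m %/ c i)%Z%:P * w').
    rewrite hE; apply/(model_ker M) => /=; rewrite gez0_abs //.
    have -> : geo i + 'X^i * q - (geo i + 'X^i * (1 + k%:P + 'X * (q' - (m %/ c i)%Z%:P * w')))
      = (m %/ c i)%Z%:P * ('X^i * w).
      have Em : (q`_0)%:P = 1 + ((m %/ c i)%Z%:P * (w`_0)%:P + k%:P) :> {poly int}.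
        by rewrite w0 -polyCM -polyCD -divz_eq /m polyCB polyC1 addrCA subrr addr0.
      rewrite [in LHS]Eq [in RHS]Ew Em; set X := 'X^i; set g := geo _.
      by set kk := k%:P; set mm := _%:P; set ww := _%:P; pring.
    exact: (idealM idJ).
  move=> [[k z]]; rewrite !inE /= => /inB[q ->] ->; rewrite hE.
  by exists (1 + (k : int)%:P + 'X * q).
move=> [k1 z1] [k2 z2]; rewrite !inE /= => /inB[q1 ->] /inB[q2 ->].
rewrite !hE => /(model_ker M) Jk.
have : J ('X^i * ((k1 : int)%:P - (k2 : int)%:P + 'X * (q1 - q2))).
  have -> // : 'X^i * ((k1 : int)%:P - (k2 : int)%:P + 'X * (q1 - q2)) =
    geo i + 'X^i * (1 + (k1 : int)%:P + 'X * q1) - (geo i + 'X^i * (1 + (k2 : int)%:P + 'X * q2)).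
  by set a := _%:P; set b := _%:P; set X := 'X^i; set g := geo _; pring.
move=> Jk'; have := cdvd _ Jk'.
rewrite coefD coefXM coefB !coefC /= addr0 -eqz_mod_dvd.
rewrite !modz_nat !modn_small // eqz_nat => /eqP/val_inj Ek; subst k2.
congr (_, _); apply/(model_ker M).
have -> // : geo i.+1 + 'X^(i.+1) * q1 - (geo i.+1 + 'X^(i.+1) * q2) =
  'X^i * ((k1 : int)%:P - (k1 : int)%:P + 'X * (q1 - q2)).
by rewrite exprS; set a := _%:P; set X := 'X^i; set g := geo _; pring.
Qed.

Lemma card_model_ret_last : #|iter n ret S| = 1%N.
Proof.
rewrite (card_ret model_cycle (pr 0)); apply/eqP/cards1P; exists (pr (geo n)).
apply/setP => x; rewrite !inE; apply/imsetP/eqP => [[y _ ->]|->].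
  have [q <-] := model_surj M y; rewrite model_iter; apply/(model_ker M).
  by rewrite addrAC subrr add0r; exact: (idealXnM idJ).
exists (pr 0) => //; rewrite model_iter; apply/(model_ker M).
by rewrite mulr0 addr0 subrr; exact: (ideal0 idJ).
Qed.

End ModelCycle.

(** * Isomorphisms and substitutions *)

Definition subst (h q : {poly int}) : {poly int} := q \Po ('X * (1 + 'X * h)).

Definition subst_rel (J J' : {poly int} -> Prop) : Prop :=
  exists h, forall q, J q <-> J' (subst h q).

Lemma substD h (q r : {poly int}) : subst h (q + r) = subst h q + subst h r.
Proof. exact: comp_polyD. Qed.
Lemma substB h (q r : {poly int}) : subst h (q - r) = subst h q - subst h r.
Proof. exact: comp_polyB. Qed.
Lemma substM h (q r : {poly int}) : subst h (q * r) = subst h q * subst h r.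
Proof. exact: comp_polyM. Qed.
Lemma substX h : subst h 'X = 'X * (1 + 'X * h).
Proof. exact: comp_polyX. Qed.
Lemma substC h c : subst h c%:P = c%:P.
Proof. exact: comp_polyC. Qed.
Lemma subst1 h : subst h 1 = 1.
Proof. exact: substC. Qed.
Lemma subst0 h : subst h 0 = 0.
Proof. exact: comp_poly0. Qed.
Lemma substXn h k : subst h 'X^k = 'X^k * (1 + 'X * h) ^+ k.
Proof. by rewrite /subst comp_Xn_poly exprMn. Qed.

Section Isomorphism.
Variables (n : nat) (J J' : {poly int} -> Prop) (S S' : braiding).
Variables (pr : {poly int} -> S) (pr' : {poly int} -> S').
Hypotheses (M : model n J pr) (M' : model n J' pr').

Let idJ := model_ideal M.
Let idJ' := model_ideal M'.

(* The map 1 + X q |-> w phi(1 + X q), where phi is the substitution X |-> X w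
   and w = 1 + X h. *)
Let twist (h q : {poly int}) := h + (1 + 'X * h) * (1 + 'X * h) * subst h q.

Let twist_star h q r : twist h (star q r) = star (twist h q) (twist h r).
Proof. by rewrite /twist /star !(substD, substM, substX, subst1); pring. Qed.

Let twist_ker h q r : pr' (twist h q) = pr' (twist h r) <-> J' (subst h (q - r)).
Proof.
rewrite (model_ker M') substB.
have -> : twist h q - twist h r =
    (1 + 'X * h) * ((1 + 'X * h) * (subst h q - subst h r)) by rewrite /twist; pring.
split=> [/(ideal_unit idJ')/(ideal_unit idJ') //|H].
by do 2 apply: (idealM idJ').
Qed.

(** The image of the base point gives h. The twist by h agrees with f there, and both respect the
    sigmas, so [circ_ind] spreads the agreement; it remains to compare kernels. *)
Lemma subst_rel_of_isomorphic : isomorphic S S' -> subst_rel J J'.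
Proof.
move=> [f fb fE].
have fs x y : f (sp x y) = sp (f x) (f y).
  have := fE x y; rewrite /= (ac_bmap (model_cycle M)) /=.
  by rewrite (ac_bmap (model_cycle M')) => -[].
have [h Eh] := model_surj M' (f (pr 0)).
pose E (a : {poly int}) := f (pr a) = pr' (twist h a).
pose H (a : {poly int}) := forall r : {poly int}, E r <-> E (circ a r).
have E0 : E 0 by rewrite /E -Eh /twist subst0 mulr0 addr0.
have EXn (a c : {poly int}) : E (a + 'X^n * c) <-> E a.
  have E1 : pr (a + 'X^n * c) = pr a.
    by apply/(model_ker M); rewrite addrC addKr; exact: (idealXnM idJ).
  have E2 : pr' (twist h (a + 'X^n * c)) = pr' (twist h a).
    apply/twist_ker; rewrite addrC addKr substM substXn -mulrA.
    exact: (idealXnM idJ').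
  by rewrite /E E1 E2.
have Hall a : H a.
  apply: (circ_ind (n := n) (E := H)) => [s|{}a b Ha Hb s|{}a b Ha Hab s|{}a c Ha s|v Hv s].
  - by have -> : circ 0 s = s by rewrite /circ; pring.
  - by rewrite circA -(Ha _) -(Hb _).
  - by rewrite (Ha (circ b s)) -circA.
  - have -> : circ (a + 'X^n * c) s = circ a s + 'X^n * (c + 'X * c * s).
      by rewrite /circ; set u := 'X^n; pring.
    by rewrite EXn.
  - have Ev : E v.
      have -> : v = circ v 0 by rewrite /circ; pring.
      exact/(Hv 0).
    rewrite -star_circ /E -(model_spE M) fs Ev twist_star -(model_spE M').
    by split=> [->|/perm_inj].
have Eall a : E a.
  have -> : a = circ a 0 by rewrite /circ; pring.
  exact/(Hall a 0).
exists h => q; rewrite -{2}[q]subr0 -twist_ker -!Eall -{1}[q]subr0 -(model_ker M).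
by split=> [->|/(bij_inj fb)].
Qed.

Lemma isomorphic_of_subst_rel : #|S| = #|S'| -> subst_rel J J' -> isomorphic S S'.
Proof.
move=> cardS [h Jh].
pose rep x : {poly int} := sval (cid (model_surj M x)).
have repK x : pr (rep x) = x by exact: svalP (cid (model_surj M x)).
pose f x := pr' (twist h (rep x)).
have fE q : f (pr q) = pr' (twist h q).
  by apply/twist_ker/Jh/(model_ker M); rewrite repK.
have f_inj : injective f.
  by move=> x y /twist_ker/Jh/(model_ker M); rewrite !repK.
have fs x y : f (sp x y) = sp (f x) (f y).
  by rewrite -{1}[x]repK -{1}[y]repK (model_spE M) fE twist_star -(model_spE M').
exists f; first by apply: inj_card_bij => //; rewrite cardS.
move=> x y; rewrite /= (ac_bmap (model_cycle M)) (ac_bmap (model_cycle M')) /=.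
congr (_, _); first exact: fs.
by apply: (@perm_inj _ (sp (sp (f x) (f y)))); rewrite permKV -!fs permKV.
Qed.

End Isomorphism.

(** * Construction of a finite solution from an ideal *)

Section Existence.
Variables (n : nat) (J : {poly int} -> Prop) (N : nat).
Hypotheses (idJ : trunc_ideal n J) (N_gt0 : (0 < N)%N) (JN : J (N%:Z)%:P).

Lemma ideal_take (q : {poly int}) : J (q - take_poly n q).
Proof.
rewrite -{1}[q](poly_take_drop n) addrAC subrr add0r.
by apply: (idealM idJ); exact: (idealXn idJ).
Qed.

Lemma star_congr (a a' b b' : {poly int}) :
  J (a - a') -> J (b - b') -> J (star a b - star a' b').
Proof.
move=> Ja Jb.
have -> : star a b - star a' b' = (1 + 'X * (1 + 'X * a')) * (b - b')
    + ('X * (1 + 'X * b)) * (a - a') by rewrite /star; pring.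
by apply: (idealD idJ); exact: (idealM idJ).
Qed.

Lemma star_cancel (a b c : {poly int}) : J (star a b - star a c) -> J (b - c).
Proof. by rewrite starB; exact: (ideal_unit idJ). Qed.

Lemma star_div (u q : {poly int}) : exists t, J (star u t - q).
Proof.
have [v [c E]] := one_addX_inv n (1 + 'X * u).
exists ((q - (1 + 'X * u)) * v).
have -> : star u ((q - (1 + 'X * u)) * v) - q =
   (q - (1 + 'X * u)) * ((1 + 'X * (1 + 'X * u)) * v - 1) by rewrite /star; pring.
rewrite E [1 + _ * c - 1]addrC addKr; apply: (idealM idJ); exact: (idealXnM idJ).
Qed.

(** The carrier must be a finite type, while J is a mere proposition. A class modulo J is therefore
    coded by the finite set of its representatives of degree below n with coefficients in [0, N);
    [N.-1.+1] is N, in the form that [inord] requires. *)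
Let T := {ffun 'I_n -> 'I_N.-1.+1}.
Let lift (t : T) : {poly int} := \poly_(i < n) (if insub i is Some j then (t j : nat)%:Z else 0).
Let cl (q : {poly int}) : {set T} := [set t | `[< J (q - lift t) >]].

Let cl_inhab q : exists t, t \in cl q.
Proof.
have N0 : N%:Z != 0 by case: N N_gt0.
pose t : T := [ffun j : 'I_n => inord `|(q`_j %% N)%Z|].
exists t; rewrite finset.in_set; apply/asboolP.
rewrite -[q](subrK (take_poly n q)) -addrA; apply: (idealD idJ); first exact: ideal_take.
have -> : take_poly n q - lift t = (\poly_(i < n) (q`_i %/ N)%Z) * (N%:Z)%:P.
  apply/polyP => i; rewrite coefMC coefB coef_take_poly !coef_poly.
  case: ltnP => [lt|_]; last by rewrite mul0r subrr.
  rewrite insubT /= ffunE inordK.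
    by rewrite gez0_abs ?modz_ge0 // {1}(divz_eq q`_i N) addrK.
  by rewrite prednK // -ltz_nat gez0_abs ?modz_ge0 // ltz_pmod.
exact: (idealM idJ).
Qed.

Let clP q r : cl q = cl r <-> J (q - r).
Proof.
split=> [E|Jqr].
  have [t tq] := cl_inhab q; have := tq; rewrite E; move: tq.
  rewrite !finset.in_set.
  by move=> /asboolP Jq /asboolP Jr; apply: (idealB_trans idJ Jq); exact: (idealB_sym idJ).
apply/setP => t; rewrite !finset.in_set; apply/asboolP/asboolP => H.
  by apply: (idealB_trans idJ) H; exact: (idealB_sym idJ).
exact: (idealB_trans idJ) H.
Qed.

Let C := {A : {set T} | `[< exists q, A = cl q >]}.
Let pr (q : {poly int}) : C := exist _ (cl q) (asboolT (ex_intro _ q erefl)).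
Let rep (x : C) : {poly int} := sval (cid (asboolW (svalP x))).

Let prP q r : pr q = pr r <-> J (q - r).
Proof. by rewrite -clP; split=> [[]|E] //; apply: val_inj. Qed.

Let repK x : pr (rep x) = x.
Proof. by apply: val_inj; rewrite /= -(svalP (cid (asboolW (svalP x)))). Qed.

Lemma exists_model : exists (S : braiding) (pr : {poly int} -> S), model n J pr.
Proof.
(* [tl u q] represents the preimage of q under the sigma of u. *)
pose tl (u q : {poly int}) : {poly int} := sval (cid (star_div u q)).
have tlP u q : J (star u (tl u q) - q) by exact: svalP (cid (star_div u q)).
pose bm (z : C * C) : C * C :=
  (pr (star (rep z.1) (rep z.2)), pr (tl (star (rep z.1) (rep z.2)) (rep z.1))).
exists (@Braiding C bm), pr.
have repJ q : J (rep (pr q) - q) by apply/prP; rewrite repK.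
split=> //.
- by move=> x; exists (rep x); exact: repK.
- move=> [x y]; rewrite {1}/bmap /=.
  set q := rep x; set r := rep y; set u := star q r; set t := tl u q.
  have Jq : J (star (rep (pr u)) (rep (pr t)) - q).
    by apply: (idealB_trans idJ _ (tlP u q)); exact: star_congr.
  have E1 : pr (star (rep (pr u)) (rep (pr t))) = pr q by apply/prP.
  congr (_, _); first by rewrite E1; exact: repK.
  rewrite -[RHS]repK -/r; apply/prP/(star_cancel (a := q)).
  set u' := star (rep _) _ in Jq E1 *; set t' := tl _ _.
  have -> : star q t' - star q r = (star q t' - star u' t') +
    (star u' t' - rep (pr u)) + (rep (pr u) - u).
    by rewrite /u; pring.
  apply: (idealD idJ) (repJ _); apply: (idealD idJ) (tlP _ _).
  apply: star_congr; last by rewrite subrr; exact: (ideal0 idJ).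
  by rewrite -opprB; exact: (idealN idJ).
move=> q r; rewrite /bmap /=; apply/prP.
exact: star_congr.
Qed.

End Existence.

(** * Hermite normal forms *)

Local Open Scope classical_set_scope.
Local Open Scope ring_scope.

(* The ideal of the q such that xq lies in the ideal I_M of F_n. *)
Definition row_ideal n (M : 'M[int]_n) (q : {poly int}) : Prop :=
  exists v : 'rV[int]_n, poly_rV q = v *m M.

Lemma polyX_dvdP (j : nat) (q : {poly int}) :
  (forall i, (i < j)%N -> q`_i = 0) -> exists r : {poly int}, q = 'X^j * r.
Proof.
move=> q0; exists (drop_poly j q); rewrite -{1}[q](poly_take_drop j) mulrC.
rewrite -[RHS]add0r; congr (_ + _); apply/polyP => i.
by rewrite coef_take_poly coef0; case: ifP => // /q0.
Qed.

Lemma rVpoly_poly_rV n (q : {poly int}) : rVpoly (poly_rV q : 'rV_n) = take_poly n q.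
Proof.
apply/polyP => i; rewrite coef_rVpoly coef_take_poly.
by case: insubP => [j -> <-|/negbTE->] //; rewrite mxE.
Qed.

Section Triangular.
Variables (n : nat) (M : 'M[int]_n).
Hypothesis M_tri : forall i j : 'I_n, (j < i)%N -> M i j = 0.

Lemma tri_mul_coef (v : 'rV[int]_n) (i : 'I_n) :
  (forall k : 'I_n, (k < i)%N -> v 0 k = 0) -> (v *m M) 0 i = v 0 i * M i i.
Proof.
move=> v0; rewrite mxE (bigD1 i) //= big1 ?addr0 // => k ki.
case: (ltngtP k i) => [lt|lt|/val_inj E]; last by rewrite E eqxx in ki.
  by rewrite v0 // mul0r.
by rewrite M_tri // mulr0.
Qed.

Lemma tri_mul_low (v : 'rV[int]_n) (j : nat) : (forall i, 0 < M i i) ->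
  (forall k : 'I_n, (k < j)%N -> (v *m M) 0 k = 0) ->
  forall k : 'I_n, (k < j)%N -> v 0 k = 0.
Proof.
move=> M0 vM0 k; have [m le] := ubnP (k : nat); elim: m k le => // m IH k le kj.
have := vM0 k kj; rewrite tri_mul_coef => [|i ik].
  by move/eqP; rewrite mulf_eq0 [M k k == 0]gt_eqF // orbF => /eqP.
by apply: IH; [exact: leq_trans ik le | exact: ltn_trans ik kj].
Qed.

(** Row j starts with M j j X^j. Conversely, a combination vanishing before column j involves no row
    before j, so its entry at j is a multiple of M j j. *)
Lemma mx_lead_type (c : 'I_n -> nat) : (forall i, 0 < M i i) ->
  (forall i, M i i = c i) -> lead_type (row_ideal M) c.
Proof.
move=> M0 Mc j; split.
- by rewrite -ltz_nat -Mc M0.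
- have [|r Er] := @polyX_dvdP j (rVpoly (row j M)).
    move=> i ij; rewrite coef_rVpoly; case: insubP => // k _ Ek.
    by rewrite mxE M_tri // Ek.
  exists r; last first.
    rewrite -Mc; have := congr1 (fun q : {poly int} => q`_j) Er.
    by rewrite /= coef_rVpoly_ord mxE coefXnM ltnn subnn => ->.
  by exists (delta_mx 0 j); rewrite -rowE -Er rVpolyK.
move=> r [v Ev].
have EvE (k : 'I_n) : ('X^j * r)`_k = (v *m M) 0 k by rewrite -Ev mxE.
have v0 : forall k : 'I_n, (k < j)%N -> v 0 k = 0.
  by apply: tri_mul_low => // k kj; rewrite -EvE coefXnM kj.
have := EvE j; rewrite coefXnM ltnn subnn tri_mul_coef // Mc => ->.
exact: dvdz_mull.
Qed.

End Triangular.

Section Hermite.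
Variables (n : nat) (J : {poly int} -> Prop) (c : 'I_n -> nat).
Hypotheses (idJ : trunc_ideal n J) (Jc : lead_type J c).

Let idealZ (a : int) (q : {poly int}) : J q -> J (a%:P * q).
Proof. exact: (idealM idJ). Qed.

(** Columns are reduced from left to right: subtracting a multiple of X^m w, where w has constant
    coefficient [c m], brings column m into range and leaves the earlier columns alone. *)
Lemma hermite_row (i : 'I_n) : exists v : 'rV[int]_n,
  [/\ J (rVpoly v), forall k : 'I_n, (k < i)%N -> v 0 k = 0, v 0 i = c i
    & forall k : 'I_n, (i < k)%N -> 0 <= v 0 k < c k].
Proof.
suff red (m : nat) : exists r : {poly int}, [/\ J ('X^i * r), r`_0 = c i
    & forall k : 'I_n, (i < k < m)%N -> 0 <= ('X^i * r)`_k < c k].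
  have [r [Jr r0 rk]] := red n; exists (poly_rV ('X^i * r)); split.
  - rewrite rVpoly_poly_rV -[take_poly _ _](subrK ('X^i * r)).
    by apply: (idealD idJ) => //; apply: (idealB_sym idJ); exact: ideal_take.
  - by move=> k ki; rewrite mxE coefXnM ki.
  - by rewrite mxE coefXnM ltnn subnn.
  - by move=> k ik; rewrite mxE; apply: rk; rewrite ik ltn_ord.
elim: m => [|m [r [Jr r0 rk]]].
  by have [_ [r Jr r0] _] := Jc i; exists r; split=> // k; rewrite ltn0 andbF.
case: (ltnP i m) => [im|mi]; last first.
  exists r; split=> // k /andP[ik]; rewrite ltnS => km.
  by have := leq_trans ik (leq_trans km mi); rewrite ltnn.
case: (ltnP m n) => [mn|nm]; last first.
  exists r; split=> // k /andP[ik _]; apply: rk.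
  by rewrite ik; exact: leq_trans (ltn_ord k) nm.
pose km := Ordinal mn; have [c_gt0 [w Jw w0] _] := Jc km.
pose a := (('X^i * r)`_m %/ c km)%Z.
have E : 'X^i * (r - a%:P * ('X^(m - i) * w)) = 'X^i * r - a%:P * ('X^m * w).
  rewrite -{2}(subnKC (ltnW im)) exprD.
  by set u := 'X^i; set u' := 'X^_; set aa := a%:P; pring.
exists (r - a%:P * ('X^(m - i) * w)); split.
- by rewrite E; apply: (idealB idJ) => //; exact: idealZ.
- by rewrite coefB coefCM coefXnM subn_gt0 im mulr0 subr0.
move=> k /andP[ik]; rewrite ltnS E coefB coefCM [('X^m * w)`_k]coefXnM.
rewrite leq_eqVlt => /orP[/eqP Ek|km'].
  have -> : k = km by exact: val_inj.
  rewrite ltnn subnn w0 /a /=; set b := ('X^i * r)`_m.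
  have c0 : (c km)%:Z != 0 by rewrite gt_eqF.
  rewrite {1 3}(divz_eq b (c km)) addrAC subrr add0r.
  by rewrite modz_ge0 //= ltz_pmod.
by rewrite km' mulr0 subr0; apply: rk; rewrite ik km'.
Qed.

Lemma hermite_exists : exists M : 'M[int]_n,
  [/\ forall i j : 'I_n, (j < i)%N -> M i j = 0,
      forall i j : 'I_n, 0 <= M i j,
      forall i j : 'I_n, i != j -> M i j < M j j,
      forall i : 'I_n, M i i = c i
    & forall i, J (rVpoly (row i M))].
Proof.
pose v i := sval (cid (hermite_row i)).
have vP i := svalP (cid (hermite_row i)).
have c_gt0 i : (0 : int) < c i by have [] := Jc i.
exists (\matrix_(i, j) v i 0 j); split.
- by move=> i j ji; rewrite mxE; have [_ + _ _] := vP i; exact.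
- move=> i j; rewrite mxE; have [_ v0 vi vk] := vP i.
  case: (ltngtP j i) => [/v0->//|/vk/andP[]//|/val_inj->].
  by rewrite -/(v i) in vi; rewrite vi.
- move=> i j ij; rewrite !mxE; have [_ v0 _ vk] := vP i; have [_ _ vj _] := vP j.
  rewrite [X in _ < X]vj; case: (ltngtP j i) => [/v0->//|/vk/andP[]//|/val_inj E].
  by rewrite E eqxx in ij.
- by move=> i; rewrite mxE; have [] := vP i.
move=> i; have [Jv _ _ _] := vP i.
by have -> : row i (\matrix_(i, j) v i 0 j) = v i by apply/rowP => j; rewrite !mxE.
Qed.

Variable M : 'M[int]_n.
Hypothesis M_tri : forall i j : 'I_n, (j < i)%N -> M i j = 0.
Hypothesis M_diag : forall i : 'I_n, M i i = c i.
Hypothesis M_rows : forall i, J (rVpoly (row i M)).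

(** Elimination from the left: the first nonzero coefficient, in column j, is a multiple of [c j]
    and is cleared by row j. With k = 0 the rows span J; with rows after the k-th only, this yields
    the shift condition of [Mset]. *)
Lemma hermite_span (B : set 'rV[int]_n) (k : nat) (q : {poly int}) : is_subgroup B ->
  (forall i : 'I_n, (k <= i)%N -> B (row i M)) -> J q ->
  (forall i, (i < k)%N -> q`_i = 0) -> B (poly_rV q).
Proof.
move=> [B0 BB] Brow Jq q0.
have B0' : B 0 by rewrite inE in B0.
have BB' u v : B u -> B v -> B (u - v) by move=> Bu Bv; have := BB u v; rewrite !inE; apply.
have BD u v : B u -> B v -> B (u + v).
  by move=> Bu Bv; rewrite -[v]opprK -[- v]sub0r; apply: (BB') => //; apply: BB'.
have BZ (a : int) u : B u -> B (a *: u).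
  move=> Bu; elim/int_ind: a => [|a IH|a IH]; first by rewrite scale0r.
    by rewrite intS scalerDl scale1r; exact: BD.
  by rewrite intS opprD scalerDl addrC scaleN1r; exact: BB'.
have q_zero (r : {poly int}) : (forall i, (i < n)%N -> r`_i = 0) -> B (poly_rV r).
  move=> r0; suff -> : poly_rV r = 0 :> 'rV_n by [].
  by apply/rowP => i; rewrite !mxE r0.
case: (leqP n k) => [nk|kn].
  by apply: q_zero => i lt; apply: q0; exact: leq_trans lt nk.
suff down (m : nat) : forall j, (j + m = n)%N -> (k <= j)%N -> forall q : {poly int}, J q ->
    (forall i, (i < j)%N -> q`_i = 0) -> B (poly_rV q).
  by apply: (down (n - k)%N k) => //; rewrite subnKC // ltnW.
elim: m => [|m IH] j jm kj {q0 Jq}q Jq q0; first by apply: q_zero; rewrite -jm addn0.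
have jn : (j < n)%N by rewrite -jm -addSnnS leq_addr.
pose j' := Ordinal jn; have [c_gt0 _ cdvd] := Jc j'.
have [r Er] := polyX_dvdP q0.
have r0 : q`_j = r`_0 by rewrite Er coefXnM ltnn subnn.
have /dvdzP[a Ea] : (c j' %| q`_j)%Z by rewrite r0; apply: cdvd; rewrite -Er.
pose q' := q - a%:P * rVpoly (row j' M).
have -> : poly_rV q = poly_rV q' + a *: row j' M :> 'rV_n.
  apply/rowP => i; rewrite !mxE coefB coefCM.
  by rewrite (coef_rVpoly_ord (row j' M)) mxE subrK.
apply: BD; last by apply: BZ; exact: Brow.
apply: (IH j.+1); first by rewrite addSnnS.
- exact: leq_trans kj _.
- by apply: (idealB idJ) => //; exact: idealZ.
move=> i; rewrite ltnS leq_eqVlt coefB coefCM => /orP[/eqP->|ij].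
  by rewrite (coef_rVpoly_ord (row j' M) j') mxE M_diag Ea subrr.
have iN : (i < n)%N := ltn_trans ij jn.
rewrite q0 // (coef_rVpoly_ord (row j' M) (Ordinal iN)) mxE M_tri //.
by rewrite mulr0 subr0.
Qed.

Lemma hermite_ideal (q : {poly int}) : J q <-> row_ideal M q.
Proof.
split=> [Jq|[v Ev]].
  apply: (@hermite_span [set u | exists v : 'rV_n, u = v *m M] 0%N) => //.
    split=> [|u v]; rewrite !inE; first by exists 0; rewrite mul0mx.
    by move=> [u' ->] [v' ->]; exists (u' - v'); rewrite mulmxBl.
  by move=> i _; exists (delta_mx 0 i); rewrite rowE.
have Jv : J (rVpoly (poly_rV q : 'rV_n)).
  rewrite Ev mulmx_sum_row raddf_sum /=.
  elim/big_ind: _ => [|x y|i _]; [exact: (ideal0 idJ) | exact: (idealD idJ) |].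
  rewrite linearZ /= -mul_polyC.
  exact: idealZ.
rewrite rVpoly_poly_rV in Jv.
by rewrite -[q](subrK (take_poly n q)); apply: (idealD idJ) Jv; exact: ideal_take.
Qed.

End Hermite.

Lemma poly_rV_XM n (q : {poly int}) : poly_rV ('X * q) = s_plus (poly_rV q) :> 'rV_n.
Proof.
apply/rowP => j; rewrite !mxE coefXM; case: ifP => // /negbT j0 /=.
congr (q`_ _); case: (j : nat) (ltn_ord j) j0 => // k kn _.
by rewrite addSn /= modnDr modn_small // ltnW.
Qed.

Lemma s_plusD n (u v : 'rV[int]_n) : s_plus (u + v) = s_plus u + s_plus v.
Proof. by apply/rowP => j; rewrite !mxE; case: ifP; rewrite ?addr0. Qed.

Lemma s_plusZ n a (u : 'rV[int]_n) : s_plus (a *: u) = a *: s_plus u.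
Proof. by apply/rowP => j; rewrite !mxE; case: ifP; rewrite ?mulr0 // !mxE. Qed.

Lemma gen_subgroup_min (V : zmodType) (A B : set V) :
  is_subgroup B -> A `<=` B -> gen_subgroup A `<=` B.
Proof. by move=> sB AB x; apply. Qed.

Lemma gen_subgroup_sub (V : zmodType) (A : set V) : A `<=` gen_subgroup A.
Proof. by move=> x Ax B [_]; apply. Qed.

Lemma gen_subgroupP (V : zmodType) (A : set V) : is_subgroup (gen_subgroup A).
Proof. exact: smallest_subgroup. Qed.

Section MatrixSet.
Variables (p n : nat) (d : 'I_n -> nat).
Hypothesis p_prime : prime p.

Lemma Mset_lead_type M : Mset p d M -> lead_type (row_ideal M) (fun i => p ^ d i)%N.
Proof.
move=> [M_tri _ _ _ M_diag]; apply: mx_lead_type => // i.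
by rewrite M_diag ltz_nat expn_gt0 prime_gt0.
Qed.

Lemma rowspan_subgroup (M : 'M[int]_n) :
  is_subgroup [set u | exists v : 'rV_n, u = v *m M].
Proof.
split=> [|u v]; rewrite !inE; first by exists 0; rewrite mul0mx.
by move=> [u' ->] [v' ->]; exists (u' - v'); rewrite mulmxBl.
Qed.

Lemma row_idealB (M : 'M[int]_n) a b : row_ideal M a -> row_ideal M b -> row_ideal M (a - b).
Proof.
by move=> [u Eu] [v Ev]; exists (u - v); rewrite mulmxBl -Eu -Ev raddfB.
Qed.

Lemma Mset_ideal M : Mset p d M -> trunc_ideal n (row_ideal M).
Proof.
move=> [M_tri M_ge0 _ M_shift M_diag].
have XM q : row_ideal M q -> row_ideal M ('X * q).
  move=> [v Ev]; rewrite /row_ideal poly_rV_XM Ev mulmx_sum_row.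
  elim/big_ind: _ => [|x y [u Eu] [w Ew]|i _].
  - by exists 0; rewrite mul0mx; apply/rowP => j; rewrite !mxE if_same.
  - by exists (u + w); rewrite s_plusD mulmxDl Eu Ew.
  rewrite s_plusZ; have [|w ->] := gen_subgroup_min (rowspan_subgroup M) _ (M_shift i).
    by move=> _ [k _ <-]; exists (delta_mx 0 k); rewrite rowE.
  by exists (v 0 i *: w); rewrite scalemxAl.
split; first exact: row_idealB.
  move=> a b Jb; elim/polyX_ind: a => [|a c Ja].
    by rewrite mul0r; exists 0; rewrite mul0mx raddf0.
  have [v Ev] := Jb; have [w Ew] := XM _ Ja; exists (w + c *: v).
  by rewrite mulrDl -mulrA raddfD /= Ew mul_polyC linearZ /= Ev mulmxDl scalemxAl.
exists 0; rewrite mul0mx; apply/rowP => j; rewrite !mxE coefXn.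
by rewrite ltn_eqF.
Qed.

(** The adjugate writes det M times any vector as a combination of the rows, and det M is the
    product of the diagonal. *)
Lemma Mset_modulus M : Mset p d M -> row_ideal M ((modulus p d)%:Z)%:P.
Proof.
move=> [M_tri _ _ _ M_diag].
have detM : \det M = (modulus p d)%:Z.
  rewrite -det_tr det_trig; last by apply/is_trig_mxP => i j ij; rewrite mxE M_tri.
  rewrite /modulus expn_sum; rewrite (big_morph Posz PoszM (erefl 1%:Z)).
  by apply: eq_bigr => i _; rewrite mxE M_diag.
exists (poly_rV 1 *m \adj M); rewrite -mulmxA mul_adj_mx detM mul_mx_scalar.
by apply/rowP => i; rewrite !mxE coefC coef1; case: eqP => _; rewrite ?mulr1 ?mulr0.
Qed.

Lemma Mset_exists J : trunc_ideal n J -> lead_type J (fun i => p ^ d i)%N ->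
  exists2 M, Mset p d M & forall q, J q <-> row_ideal M q.
Proof.
move=> idJ Jc; have [M [M_tri M_ge0 M_lt M_diag M_rows]] := hermite_exists idJ Jc.
exists M; last by move=> q; exact: (hermite_ideal idJ Jc).
split=> // k.
have -> : s_plus (row k M) = poly_rV ('X * rVpoly (row k M)).
  by rewrite poly_rV_XM rVpolyK.
apply: (hermite_span idJ Jc M_tri M_diag M_rows (k := k.+1)).
- exact: gen_subgroupP.
- by move=> i ki; apply: gen_subgroup_sub; exists i.
- exact: (idealM idJ).
move=> i; rewrite ltnS coefXM; case: i => // i ik /=.
rewrite coef_rVpoly; case: insubP => // j _ Ej.
by rewrite mxE M_tri // Ej.
Qed.

(** By induction on the column: where two i-th rows first may differ, at j > i, the difference is a
    multiple of the common diagonal entry M j j, and both entries lie in [0, M j j). *)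
Lemma Mset_inj M M' : Mset p d M -> Mset p d M' ->
  (forall q, row_ideal M q <-> row_ideal M' q) -> M = M'.
Proof.
move=> SM SM' E; have Jc := Mset_lead_type SM.
have [M_tri M_ge0 M_lt _ M_diag] := SM; have [M_tri' M_ge0' M_lt' _ M_diag'] := SM'.
have Mrow (A : 'M[int]_n) i : row_ideal A (rVpoly (row i A)).
  by exists (delta_mx 0 i); rewrite -rowE rVpolyK.
apply/matrixP => i j; have [m le] := ubnP (j : nat); elim: m j le => // m IH j le.
case: (ltngtP j i) => [ji|ij|/val_inj->]; last by rewrite M_diag M_diag'.
  by rewrite M_tri // M_tri'.
pose D := rVpoly (row i M - row i M').
have DE (k : 'I_n) : D`_k = M i k - M' i k by rewrite coef_rVpoly_ord !mxE.
have JD : row_ideal M D.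
  rewrite /D raddfB; apply: row_idealB.
  - exact: Mrow.
  - by apply/E; exact: Mrow.
have [|r Er] := @polyX_dvdP j D.
  move=> k kj; rewrite -[k]/(val (Ordinal (ltn_trans kj (ltn_ord j)))) DE IH ?subrr //.
  exact: leq_trans kj le.
have [_ _ /(_ r)] := Jc j; rewrite -Er => /(_ JD).
have -> : r`_0 = M i j - M' i j by rewrite -DE Er coefXnM ltnn subnn.
have ij' : i != j by rewrite -val_eqE /= ltn_eqF.
have := M_lt i j ij'; have := M_lt' i j ij'; rewrite M_diag M_diag'.
have := M_ge0 i j; have := M_ge0' i j; set x := M i j; set y := M' i j.
move=> y0 x0 yc xc; rewrite -eqz_mod_dvd !modz_small ?x0 ?y0 //=; first by move/eqP.
Qed.

End MatrixSet.

(** * The rings F_n and their automorphisms *)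

Section TruncatedRing.
Variable n : nat.

Local Notation tr := (in_qpoly ('X^(n.+1) : {poly int})).

Lemma trunc_Xn : tr 'X^(n.+1) = 0.
Proof. by apply: val_inj; rewrite /= mk_monic_Xn Pdiv.RingMonic.rmodpp ?monicXn. Qed.

Lemma truncE (q : {poly int}) : tr q = take_poly n.+1 q :> {poly int}.
Proof.
rewrite -{1}[q](poly_take_drop n.+1) in_qpolyD in_qpolyM trunc_Xn.
rewrite mulr0 addr0 in_qpoly_small // mk_monic_Xn size_polyXn ltnS.
exact: size_take_poly.
Qed.

Lemma Fpred_trunc (q : {poly int}) : (tr ('X * q) : trunc_ring n) \in @Fpred n.
Proof.
elim/polyX_ind: q => [|q c Fq]; first by rewrite mulr0 in_qpoly0; exact: rpred0.
rewrite mulrDr in_qpolyD; apply: rpredD.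
  by rewrite in_qpolyM; exact: (Fpred_mul (InF (Fpred_X n)) (InF Fq)).
rewrite mulrC mul_polyC -[c]intz scaler_int raddfMz.
apply: rpredMz; exact: Fpred_X.
Qed.

(* The additive surjection q |-> x q from Z[x] onto F_n. *)
Definition Fpoly (q : {poly int}) : F n := InF (Fpred_trunc q).

Fact Fpoly_is_zmod_morphism : zmod_morphism Fpoly.
Proof. by move=> q r; apply: val_inj; rewrite raddfB /= mulrBr raddfB. Qed.

HB.instance Definition _ :=
  GRing.isZmodMorphism.Build {poly int} (F n) Fpoly Fpoly_is_zmod_morphism.

Lemma FpolyM (q r : {poly int}) : Fmul (Fpoly q) (Fpoly r) = Fpoly ('X * q * r).
Proof.
apply: val_inj => /=; rewrite -in_qpolyM; congr (tr _).
by pring.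
Qed.

Lemma Fpoly1 : Fpoly 1 = Fx n.
Proof. by apply: val_inj; rewrite /= mulr1. Qed.

Lemma FpolyCM (c : int) (q : {poly int}) : Fpoly (c%:P * q) = Fpoly q *~ c.
Proof. by rewrite -raddfMz -mulrzl -[c in LHS]intz rmorph_int. Qed.

Lemma Fpoly_ker (q : {poly int}) : Fpoly q = 0 <-> exists c : {poly int}, q = 'X^n * c.
Proof.
split=> [E|[c ->]].
  have q0 : polyn (F_val (Fpoly q)) = polyn (F_val (0 : F n)) by rewrite E.
  rewrite (truncE _ : polyn (F_val (Fpoly q)) = _) in q0; apply: polyX_dvdP => i lt.
  have := congr1 (fun a : {poly int} => a`_i.+1) q0.
  by rewrite /= coef_take_poly ltnS lt coefXM coef0.
by apply: val_inj; rewrite /= mulrA -exprS in_qpolyM trunc_Xn mul0r.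
Qed.

Lemma Fpoly_eq (q r : {poly int}) :
  Fpoly q = Fpoly r <-> exists c : {poly int}, q - r = 'X^n * c.
Proof.
rewrite -Fpoly_ker raddfB /=; split=> [->|/eqP]; first by rewrite subrr.
by rewrite subr_eq0 => /eqP.
Qed.

Lemma Fpoly_surj (a : F n) : exists q, Fpoly q = a.
Proof.
have /asboolP := valP a.
move=> /(_ [set t | exists q, t = tr ('X * q)])[].
  split; last by move=> _ ->; exists 1; rewrite mulr1.
  split=> [|_ _ [q ->] [r ->]].
    split=> [|u v]; rewrite !inE; first by exists 0; rewrite mulr0 in_qpoly0.
    by move=> [q ->] [r ->]; exists (q - r); rewrite mulrBr raddfB.
  by exists ('X * q * r); rewrite -in_qpolyM; congr (tr _); pring.
by move=> q Eq; exists q; apply: val_inj; rewrite Eq.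
Qed.

Lemma Fxpow_poly k : Fxpow n k = Fpoly 'X^k.
Proof.
elim: k => [|k IH]; first by rewrite expr0 Fpoly1.
by rewrite /Fxpow iterS -/(Fxpow n k) IH -Fpoly1 FpolyM mulr1 exprS.
Qed.

Lemma Frow_poly (v : 'rV[int]_n) : Frow v = Fpoly (rVpoly v).
Proof.
rewrite [in RHS](row_sum_delta v) !raddf_sum; apply: eq_bigr => j _.
by rewrite /= linearZ /= rVpoly_delta -mul_polyC FpolyCM Fxpow_poly.
Qed.

Lemma I_mx_poly (M : 'M[int]_n) (q : {poly int}) :
  I_mx M (Fpoly q) <-> row_ideal M q.
Proof.
split=> [|[v Ev]].
  have : I_mx M `<=` [set a | exists2 q, a = Fpoly q & row_ideal M q].
    apply: gen_subgroup_min.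
      split=> [|a b]; rewrite !inE.
        by exists 0; [rewrite raddf0 | exists 0; rewrite mul0mx raddf0].
      move=> [r -> Jr] [s -> Js]; exists (r - s); first by rewrite raddfB.
      exact: row_idealB.
    move=> _ [i _ <-]; exists (rVpoly (row i M)); first exact: Frow_poly.
    by exists (delta_mx 0 i); rewrite -rowE rVpolyK.
  move=> sub /sub[r /Fpoly_eq[c Ec] [v Ev]]; exists v.
  rewrite -Ev; apply/rowP => j; rewrite !mxE -[q](subrK r) Ec coefD coefXnM.
  by rewrite ltn_ord add0r.
have -> : Fpoly q = \sum_i Frow (row i M) *~ v 0 i.
  have -> : Fpoly q = Fpoly (rVpoly (poly_rV q : 'rV_n)).
    apply/Fpoly_eq; exists (drop_poly n q).
    by rewrite rVpoly_poly_rV -{1}[q](poly_take_drop n) addrAC subrr add0r mulrC.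
  rewrite Ev mulmx_sum_row !raddf_sum; apply: eq_bigr => i _ /=.
  by rewrite linearZ /= -mul_polyC FpolyCM Frow_poly.
have [I0 IB] : is_subgroup (I_mx M) by exact: gen_subgroupP.
have IB' u w : I_mx M u -> I_mx M w -> I_mx M (u - w).
  by move=> Iu Iw; have := IB u w; rewrite !inE; apply.
have I0' : I_mx M 0 by rewrite inE in I0.
have ID u w : I_mx M u -> I_mx M w -> I_mx M (u + w).
  by move=> Iu Iw; rewrite -[w]opprK -[- w]sub0r; apply: (IB') => //; apply: IB'.
elim/big_ind: _ => // i _.
have Ii : I_mx M (Frow (row i M)) by apply: gen_subgroup_sub; exists i.
elim/int_ind: (v 0 i) => [|a IH|a IH]; first by rewrite mulr0z.
  by rewrite intS mulrzDr mulr1z; exact: ID.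
by rewrite intS opprD mulrzDr addrC mulrN1z; exact: IB'.
Qed.

Variable N : nat.

(** The ideal (N, X^n) of Z[X], which q |-> xq maps onto the ideal (N x) of F_n. *)
Definition quot_ideal (q : {poly int}) : Prop :=
  exists a b : {poly int}, q = (N%:Z)%:P * a + 'X^n * b.

Lemma quot_trunc_ideal : trunc_ideal n quot_ideal.
Proof.
split.
- move=> _ _ [a [b ->]] [a' [b' ->]]; exists (a - a'), (b - b').
  by set u := 'X^n; set v := _%:P; pring.
- move=> q _ [a [b ->]]; exists (q * a), (q * b).
  by set u := 'X^n; set v := _%:P; pring.
by exists 0, 1; rewrite mulr0 add0r mulr1.
Qed.

Lemma Fideal_poly (q : {poly int}) : Fpoly q \in Fideal N <-> quot_ideal q.
Proof.
have FN : Fx n *+ N = Fpoly (N%:Z)%:P by rewrite -[_%:P]mulr1 FpolyCM Fpoly1.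
split=> [/asboolP|[a [b ->]]].
  move=> /(_ [set a | exists2 q, a = Fpoly q & quot_ideal q])[].
    split; last first.
      move=> _ ->; exists (N%:Z)%:P => //; exists 1, 0.
      by rewrite mulr1 mulr0 addr0.
    split=> [|a _ [r -> Jr]].
      split=> [|a b]; rewrite !inE.
        by exists 0; [rewrite raddf0 | exact: (ideal0 quot_trunc_ideal)].
      move=> [r -> Jr] [s -> Js]; exists (r - s); first by rewrite raddfB.
      exact: (idealB quot_trunc_ideal).
    have [s <-] := Fpoly_surj a; rewrite !FpolyM; split.
      by exists ('X * s * r) => //; exact: (idealM quot_trunc_ideal).
    by exists ('X * r * s) => //; rewrite mulrAC; exact: (idealM quot_trunc_ideal).
  move=> r /Fpoly_eq[c Ec] Jr; rewrite -[q](subrK r) Ec.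
  by apply: (idealD quot_trunc_ideal) Jr; exact: (idealXnM quot_trunc_ideal).
have -> : Fpoly ((N%:Z)%:P * a + 'X^n * b) = Fpoly ((N%:Z)%:P * a).
  by apply/Fpoly_eq; exists b; rewrite addrAC subrr add0r.
apply/asboolP => B [[[B0 BB] BM] BN].
have B0' : B 0 by rewrite inE in B0.
have BB' u w : B u -> B w -> B (u - w).
  by move=> Iu Iw; have := BB u w; rewrite !inE; apply.
have BD u w : B u -> B w -> B (u + w).
  by move=> Iu Iw; rewrite -[w]opprK -[- w]sub0r; apply: (BB') => //; apply: BB'.
elim/polyX_ind: a => [|a c Ba]; first by rewrite mulr0 raddf0.
have -> : (N%:Z)%:P * ('X * a + c%:P) = 'X * 1 * ((N%:Z)%:P * a) + c%:P * (N%:Z)%:P.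
  by set u := _%:P; set v := _%:P; pring.
rewrite raddfD /= -FpolyM (FpolyCM c) -FN; apply: (BD); first by have [] := BM (Fpoly 1) _ Ba.
have Bx : B (Fx n *+ N) by exact: BN.
elim/int_ind: c => [|m IH|m IH]; first by rewrite mulr0z.
  by rewrite intS mulrzDr mulr1z; exact: BD.
by rewrite intS opprD mulrzDr addrC mulrN1z; exact: BB'.
Qed.

Local Open Scope quotient_scope.

Definition Fmpoly (q : {poly int}) : Fmod n N := \pi_(Fmod n N) (Fpoly q).

Lemma FmpolyB (q r : {poly int}) : Fmpoly (q - r) = Fmpoly q - Fmpoly r.
Proof. by rewrite /Fmpoly raddfB; exact: raddfB. Qed.

HB.instance Definition _ :=
  GRing.isZmodMorphism.Build {poly int} (Fmod n N) Fmpoly FmpolyB.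

Lemma Fmpoly_eq (q r : {poly int}) : Fmpoly q = Fmpoly r <-> quot_ideal (q - r).
Proof.
rewrite -Fideal_poly raddfB Quotient.idealrBE.
exact: (rwP eqP).
Qed.

Lemma Fmpoly_surj (u : Fmod n N) : exists q, Fmpoly q = u.
Proof.
have [q Eq] := Fpoly_surj (generic_quotient.repr u).
by exists q; rewrite /Fmpoly Eq reprK.
Qed.

Lemma FmpolyM (q r : {poly int}) : Fmod_mul (Fmpoly q) (Fmpoly r) = Fmpoly ('X * q * r).
Proof. by rewrite /Fmpoly Fmod_mulE FpolyM. Qed.

Lemma Fmpoly1 : Fmpoly 1 = Fmod_x n N.
Proof. by rewrite /Fmpoly Fpoly1. Qed.

Lemma FmpolyCM (c : int) (q : {poly int}) : Fmpoly (c%:P * q) = Fmpoly q *~ c.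
Proof. by rewrite -raddfMz -mulrzl -[c in LHS]intz rmorph_int. Qed.

Lemma quot_ideal_sub (J : {poly int} -> Prop) : trunc_ideal n J -> J (N%:Z)%:P ->
  forall q, quot_ideal q -> J q.
Proof.
move=> idJ JN _ [a [b ->]]; apply: (idealD idJ); last exact: (idealXnM idJ).
by rewrite mulrC; apply: (idealM idJ).
Qed.

Lemma I_mod_poly (M : 'M[int]_n) (q : {poly int}) : trunc_ideal n (row_ideal M) ->
  row_ideal M (N%:Z)%:P -> I_mod N M (Fmpoly q) <-> row_ideal M q.
Proof.
move=> idM MN; split=> [[a Ia Ea]|Mq]; last by exists (Fpoly q) => //; apply/I_mx_poly.
have [r Er] := Fpoly_surj a; move: Ia Ea; rewrite -Er => /I_mx_poly Mr.
move=> /Fmpoly_eq/(quot_ideal_sub idM MN) Mrq.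
by rewrite -[q](subrK r); apply: (idealD idM) Mr; exact: (idealB_sym idM).
Qed.

Lemma rng_square_poly (u : Fmod n N) :
  rng_square (@Fmod_mul n N) u <-> exists h, u = Fmpoly ('X * h).
Proof.
split=> [|[h ->]]; last first.
  rewrite -[h in 'X * h]mulr1 mulrA -FmpolyM.
  by apply: gen_subgroup_sub; exists (Fmpoly h) => //; exists (Fmpoly 1).
apply: (gen_subgroup_min (B := [set u | exists h, u = Fmpoly ('X * h)])).
  split=> [|a b]; rewrite !inE; first by exists 0; rewrite mulr0 raddf0.
  by move=> [q ->] [r ->]; exists (q - r); rewrite mulrBr raddfB.
move=> _ [a _ [b _ <-]]; have [[q <-] [r <-]] := (Fmpoly_surj a, Fmpoly_surj b).
by exists (q * r); rewrite FmpolyM mulrA.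
Qed.

(** The coset condition gives phi(x) = x (1 + xh), which determines phi. As [Fmpoly q] stands for
    xq, the initial x contributes the factor 1 + X h. *)
Lemma AutF_poly (phi : Fmod n N -> Fmod n N) : AutF phi ->
  exists h, forall q, phi (Fmpoly q) = Fmpoly ((1 + 'X * h) * subst h q).
Proof.
move=> [_ phiD phiM phi_coset].
have phiB : zmod_morphism phi.
  by move=> u v; apply/eqP; rewrite eq_sym subr_eq -phiD subrK.
have phiZ (c : int) u : phi (u *~ c) = phi u *~ c.
  pose f : {additive Fmod n N -> Fmod n N} :=
    HB.pack phi (GRing.isZmodMorphism.Build _ _ phi phiB).
  exact: (raddfMz f).
have [h Eh] : exists h, phi (Fmpoly 1) = Fmpoly (1 + 'X * h).
  have [|_ /rng_square_poly[h ->] <-] := phi_coset (phi (Fmpoly 1)).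
    exists (Fmpoly 1) => //; exists 0; last by rewrite Fmpoly1 addr0.
    by apply/rng_square_poly; exists 0; rewrite mulr0 raddf0.
  by exists h; rewrite raddfD /= Fmpoly1.
exists h; elim/polyX_ind => [|q c IH].
  rewrite subst0 mulr0 raddf0; apply/eqP.
  by rewrite -[0]subr0 phiB subrr subr0.
rewrite raddfD /= phiD -[X in Fmpoly ('X * X)]mulr1 mulrA -FmpolyM phiM IH Eh FmpolyM.
rewrite -[c%:P]mulr1 FmpolyCM phiZ Eh -FmpolyCM -raddfD mulr1; congr Fmpoly.
by rewrite substD substM substX substC; set s := subst h q; set z := c%:P; pring.
Qed.

Lemma expr_1addXM (h : {poly int}) k : exists e, (1 + 'X * h) ^+ k = 1 + 'X * e.
Proof.
elim: k => [|k [e E]]; first by exists 0; rewrite mulr0 addr0.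
by exists (h + e + 'X * h * e); rewrite exprS E; pring.
Qed.

(** One degree at a time: X^k is sent to X^k (1 + X h)^(k+1), whose lowest term is X^k, so adding to
    r the lowest term of the error removes it. *)
Lemma subst_surj h (q : {poly int}) :
  exists r c : {poly int}, q - (1 + 'X * h) * subst h r = 'X^n * c.
Proof.
elim: n => [|k [r [c E]]]; first by exists 0, q; rewrite subst0 mulr0 subr0 mul1r.
have [c' Ec] := poly_coef0_split c; have [e Ee] := expr_1addXM h k.+1.
exists (r + 'X^k * (c`_0)%:P), (c' - e * (c`_0)%:P).
have -> : q = 'X^k * c + (1 + 'X * h) * subst h r by rewrite -E subrK.
rewrite substD substM substXn substC {1}Ec exprS.
have -> : forall a b d : {poly int}, a * (b + d * (1 + 'X * h) ^+ k * (c`_0)%:P) =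
   a * b + d * (a * (1 + 'X * h) ^+ k) * (c`_0)%:P.
  by move=> a b d; set w := _ ^+ k; set z := _%:P; pring.
rewrite -exprS Ee; set u := 'X^k; set z := _%:P; set s := subst h r.
by pring.
Qed.

Lemma subst_dvdXn h (q c : {poly int}) : subst h q = 'X^n * c ->
  exists r : {poly int}, q = 'X^n * r.
Proof.
move=> E; suff dvd k : (k <= n)%N -> exists r : {poly int}, q = 'X^k * r by exact: dvd.
elim: k => [_|k IH kn]; first by exists q; rewrite mul1r.
have [r Er] := IH (ltnW kn); have [r' Er'] := poly_coef0_split r.
suff r0 : r`_0 = 0 by exists r'; rewrite Er {1}Er' r0 add0r mulrA -exprSr.
have := congr1 (fun p : {poly int} => p`_k) E.
rewrite Er Er' substM substXn coefXnM kn; have [e ->] := expr_1addXM h k.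
rewrite -mulrA coefXnM ltnn subnn substD substC substM substX.
by rewrite mulrDl mul1r -!mulrA !coefD !coefXM coefC /= !addr0.
Qed.

(** If q is sent to N a + X^n b and r to a modulo X^n, then the image of q - N r is divisible by
    X^n, hence so is q - N r. *)
Lemma subst_quot_ideal h (q : {poly int}) : quot_ideal (subst h q) -> quot_ideal q.
Proof.
move=> [a [b E]]; have [r [c Er]] := subst_surj h ((1 + 'X * h) * a).
have [c' Ec'] : exists c' : {poly int}, a - subst h r = 'X^n * c'.
  have [v [e Ev]] := one_addX_inv n h; exists (v * c - e * (a - subst h r)).
  have -> : 'X^n * (v * c - e * (a - subst h r)) = v * ('X^n * c) - ('X^n * e) * (a - subst h r).
    by set u := 'X^n; pring.
  rewrite -Er; have -> : 'X^n * e = (1 + 'X * h) * v - 1 by rewrite Ev addrC addKr.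
  by set s := subst h r; pring.
have [|s Es] := @subst_dvdXn h (q - (N%:Z)%:P * r) ((N%:Z)%:P * c' + b).
  rewrite substB substM substC E -[a](subrK (subst h r)) Ec'.
  by set u := 'X^n; set v := _%:P; set w := subst h r; pring.
by exists r, s; rewrite -Es addrC subrK.
Qed.

Lemma AutF_exists h : exists phi : Fmod n N -> Fmod n N, AutF phi /\
  forall q, phi (Fmpoly q) = Fmpoly ((1 + 'X * h) * subst h q).
Proof.
pose rep (u : Fmod n N) : {poly int} := sval (cid (Fmpoly_surj u)).
have repK u : Fmpoly (rep u) = u by exact: svalP (cid (Fmpoly_surj u)).
pose phi u := Fmpoly ((1 + 'X * h) * subst h (rep u)).
have phiE q : phi (Fmpoly q) = Fmpoly ((1 + 'X * h) * subst h q).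
  apply/Fmpoly_eq; rewrite -mulrBr -substB; apply: (idealM quot_trunc_ideal).
  have /Fmpoly_eq[a [b ->]] := repK (Fmpoly q).
  exists (subst h a), ((1 + 'X * h) ^+ n * subst h b).
  by rewrite substD !substM substC substXn mulrA.
exists phi; split=> //; split.
- have phi_inj : injective phi.
    move=> u v /Fmpoly_eq; rewrite -mulrBr -substB.
    move=> /(ideal_unit quot_trunc_ideal)/subst_quot_ideal/Fmpoly_eq.
    by rewrite !repK.
  have phi_surj v : exists u, phi u = v.
    have [q <-] := Fmpoly_surj v; have [r [c Er]] := subst_surj h q.
    exists (Fmpoly r); rewrite phiE; apply/esym/Fmpoly_eq; rewrite Er.
    exact: (idealXnM quot_trunc_ideal).
  exists (fun v => sval (cid (phi_surj v))) => [u|v].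
    by apply: phi_inj; exact: svalP (cid (phi_surj (phi u))).
  exact: svalP (cid (phi_surj v)).
- move=> u v; have [[q <-] [r <-]] := (Fmpoly_surj u, Fmpoly_surj v).
  by rewrite -raddfD !phiE substD mulrDr raddfD.
- move=> u v; have [[q <-] [r <-]] := (Fmpoly_surj u, Fmpoly_surj v).
  rewrite FmpolyM !phiE FmpolyM !substM substX; congr Fmpoly.
  by set s := subst h q; set t := subst h r; pring.
move=> coset _ [_ [_ /rng_square_poly[g ->] <-] <-]; rewrite {}/coset.
rewrite -Fmpoly1 -raddfD phiE substD subst1 substM substX.
exists (Fmpoly ('X * (h + (1 + 'X * h) * (1 + 'X * h) * subst h g))).
  by apply/rng_square_poly; exists (h + (1 + 'X * h) * (1 + 'X * h) * subst h g).
by rewrite -raddfD; congr Fmpoly; set s := subst h g; pring.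
Qed.

End TruncatedRing.

Section Orbits.
Variables (p n : nat) (d : 'I_n -> nat).
Hypothesis p_prime : prime p.

Lemma orbit_mxP M M' : Mset p d M ->
  orbit_mx p d M M' <-> Mset p d M' /\ subst_rel (row_ideal M) (row_ideal M').
Proof.
move=> SM; set N := modulus p d.
have idP A : Mset p d A -> trunc_ideal n (row_ideal A) by exact: Mset_ideal.
have I_modP A q : Mset p d A -> I_mod N A (Fmpoly n N q) <-> row_ideal A q.
  by move=> SA; apply: I_mod_poly; [exact: idP | exact: Mset_modulus].
split=> [[phi phiA <-]|[SM' [h hE]]].
  rewrite /act_mx; case: xgetP => [M'' _ [SM'' EI]|_]; last first.
    (* The default value of [act_mx] is M, related to itself by h = 0. *)
    split=> //; exists 0 => q; suff -> : subst 0 q = q by [].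
    by rewrite /subst mulr0 addr0 mulr1 comp_polyXr.
  split=> //; have [h phiE] := AutF_poly phiA; exists h => q.
  have [phi_bij _ _ _] := phiA; split=> [Mq|Mq].
    apply: (ideal_unit (idP _ SM'') (a := h)); apply/(I_modP _ _ SM'').
    by rewrite EI -phiE; exists (Fmpoly n N q) => //; apply/I_modP.
  have : I_mod N M'' (phi (Fmpoly n N q)).
    by rewrite phiE; apply/I_modP => //; exact: (idealM (idP _ SM'')).
  by rewrite EI => -[z Iz /(bij_inj phi_bij) Ez]; apply/(I_modP _ _ SM); rewrite -Ez.
have [phi [phiA phiE]] := AutF_exists n N h; exists phi => //.
have EI : I_mod N M' = phi @` I_mod N M.
  apply/seteqP; split=> [u Iu|_ [u Iu <-]].
    have [q Eq] := Fmpoly_surj u; have [r [c Er]] := subst_surj n h q.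
    have Eu : u = phi (Fmpoly n N r).
      rewrite -Eq phiE; apply/Fmpoly_eq; rewrite Er.
      exact: (idealXnM (quot_trunc_ideal n N)).
    exists (Fmpoly n N r) => //; apply/I_modP => //; apply/hE.
    apply: (ideal_unit (idP _ SM') (a := h)); apply/(I_modP _ _ SM').
    by rewrite -phiE -Eu.
  have [q Eq] := Fmpoly_surj u; move: Iu; rewrite -Eq => /(I_modP _ _ SM)/hE Mq.
  by rewrite phiE; apply/I_modP => //; exact: (idealM (idP _ SM')).
rewrite /act_mx; case: xgetP => [M'' _ [SM'' EI'']|/(_ M')[]]; last by split.
apply: (Mset_inj p_prime SM'' SM') => q.
by rewrite -(I_modP _ _ SM'') -(I_modP _ _ SM') EI'' EI.
Qed.

End Orbits.

(** * The correspondence *)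

Lemma isomorphic_refl S : isomorphic S S.
Proof. by exists id => [|x y /=]; [exists id | rewrite -surjective_pairing]. Qed.

Lemma isomorphic_sym S T : isomorphic S T -> isomorphic T S.
Proof.
move=> [f [g fK gK] fE]; exists g; first by exists f.
move=> x y /=; apply/esym; have := fE (g x) (g y); rewrite /= !gK => <- /=.
by rewrite !fK -surjective_pairing.
Qed.

Lemma isomorphic_trans S T U : isomorphic S T -> isomorphic T U -> isomorphic S U.
Proof.
move=> [f fb fE] [g gb gE]; exists (g \o f); first exact: bij_comp.
by move=> x y /=; rewrite -gE /= -fE.
Qed.

Lemma model_card_neq0 n J (S : braiding) (pr : {poly int} -> S) i : model n J pr ->
  (0 < #|iter i ret S|)%N.
Proof.
move=> M; rewrite (card_ret (model_cycle M) (pr 0)) card_gt0.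
by apply/set0Pn; eexists; apply: imset_f; exact: (erefl : pr 0 \in S).
Qed.

(** S is finite, so two distinct integers fall in one class and their difference N lies in J. Every
    ideal of leading coefficients is then nonzero, generated by its least positive element. *)
Lemma model_lead_type n J (S : braiding) (pr : {poly int} -> S) : model n J pr ->
  exists c : 'I_n -> nat, lead_type J c.
Proof.
move=> M; have idJ := model_ideal M.
have [N N_gt0 JN] : exists2 N, (0 < N)%N & J (N%:Z)%:P.
  have : ~ injective (fun k : 'I_#|S|.+1 => pr ((k : nat)%:Z)%:P).
    by move=> /leq_card; rewrite card_ord ltnn.
  move=> ninj; apply: contrapT => nJ; apply: ninj => k l.
  wlog kl : k l / (k <= l)%N.
    by move=> H; case: (leqP k l) => [|/ltnW] le; [exact: H | move=> /esym/(H _ _ le)].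
  move=> /esym/(model_ker M); rewrite -polyCB subzn // => Jkl.
  apply/val_inj/eqP; rewrite /= eqn_leq kl /= leqNgt; apply/negP => lt.
  by apply: nJ; exists (l - k)%N; rewrite ?subn_gt0.
have exc (j : 'I_n) : exists m,
    (0 < m)%N && `[< exists2 r : {poly int}, J ('X^j * r) & r`_0 = m >].
  exists N; rewrite N_gt0 /=; apply/asboolP; exists (N%:Z)%:P; last by rewrite coefC.
  exact: (idealM idJ).
exists (fun j => ex_minn (exc j)) => j.
case: ex_minnP => c /andP[c_gt0 /asboolP[w Jw w0]] cmin.
split=> // [|r Jr]; first by exists w.
have cn0 : c%:Z != 0 by case: (c) c_gt0.
apply/dvdz_mod0P/eqP; apply: contraT => nz.
pose k := (r`_0 %% c)%Z.
have k_ge0 : 0 <= k by rewrite modz_ge0.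
have k_ltc : k < c by rewrite ltz_pmod.
suff : (c <= `|k|)%N by rewrite -lez_nat gez0_abs // leNgt k_ltc.
apply: cmin; rewrite absz_gt0 nz /=; apply/asboolP.
exists (r - (r`_0 %/ c)%Z%:P * w).
  rewrite mulrBr mulrCA; apply: (idealB idJ) => //; exact: (idealM idJ).
by rewrite gez0_abs // coefB coefCM w0 /k {1}(divz_eq r`_0 c) addrAC subrr add0r.
Qed.

Section Correspondence.
Variables (p n : nat) (d : 'I_n -> nat).
Hypothesis p_prime : prime p.

Local Notation AS := (AbSol (fun i => p ^ d i)%N).
Local Notation models M := (model n (row_ideal M)).

Lemma AbSol_model S : AS S ->
  exists M, Mset p d M /\ exists pr : {poly int} -> S, models M pr.
Proof.
move=> [[solS invS] indS abS card_step card_last].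
have acS : abelian_cycle S by apply: solution_abelian_cycle; split.
have [/card_gt0P[x0 _] _ _ _ _] := solS.
have [|J [pr M]] := model_of_cycle (x0 := x0) (n := n) acS.
  move: card_last; rewrite (card_ret acS x0) => /eqP/cards1P[z Ez] x y.
  have inz u : iter n (fun x => sp x x0) u = z.
    by apply/set1P; rewrite -Ez; apply: imset_f.
  by rewrite !inz.
have [c Jc] := model_lead_type M.
have cE i : c i = (p ^ d i)%N.
  have := card_model_ret_step M i Jc; rewrite card_step => /eqP.
  by rewrite eqn_pmul2r ?(model_card_neq0 _ M) // => /eqP.
have [|A SA JA] := Mset_exists (p := p) (model_ideal M) (d := d).
  by rewrite -(_ : c = fun i => p ^ d i)%N //; apply/funext.
exists A; split=> //; exists pr.
by rewrite -(_ : J = row_ideal A) //; apply/funext => q; apply/propext.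
Qed.

Lemma model_AbSol M (S : braiding) (pr : {poly int} -> S) : Mset p d M -> models M pr -> AS S.
Proof.
move=> SM mS; have acS := model_cycle mS.
have [solS invS indS abS] := cycle_solution acS (pr 0).
split=> // [i|]; last exact: card_model_ret_last mS.
exact: (card_model_ret_step mS) (Mset_lead_type p_prime SM).
Qed.

Lemma Mset_model M : Mset p d M ->
  exists (S : braiding) (pr : {poly int} -> S), models M pr.
Proof.
move=> SM; apply: (exists_model (N := modulus p d)).
- exact: Mset_ideal SM.
- by rewrite expn_gt0 prime_gt0.
- exact: Mset_modulus.
Qed.

(** Needed in [isomorphic_of_subst_rel], where the substitution only yields an injection. *)
Lemma AbSol_card S T : AS S -> AS T -> #|S| = #|T|.
Proof.
move=> [_ _ _ Sstep Slast] [_ _ _ Tstep Tlast].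
suff H k : (k <= n)%N -> #|iter (n - k) ret S| = #|iter (n - k) ret T|.
  by have := H n (leqnn n); rewrite subnn.
elim: k => [|k IH] kn; first by rewrite subn0 Slast Tlast.
have lt : (n - k.+1 < n)%N by rewrite ltn_subrL (leq_ltn_trans _ kn).
rewrite (Sstep (Ordinal lt)) (Tstep (Ordinal lt)); congr (_ * _)%N.
have E : (n - k = (n - k.+1).+1)%N by rewrite -subSn.
by move: (IH (ltnW kn)); rewrite E.
Qed.

Lemma isomorphic_models M M' (S S' : braiding) (pr : {poly int} -> S) (pr' : {poly int} -> S') :
  Mset p d M -> Mset p d M' -> models M pr -> models M' pr' ->
  isomorphic S S' <-> orbit_mx p d M M'.
Proof.
move=> SM SM' mS mS'; rewrite (orbit_mxP p_prime M' SM); split=> [iso|[_ rel]].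
  by split=> //; exact: subst_rel_of_isomorphic mS mS' iso.
apply: (isomorphic_of_subst_rel mS mS' _ rel).
by apply: AbSol_card; [exact: model_AbSol mS | exact: model_AbSol mS'].
Qed.

Lemma orbit_mx_sub M M' : Mset p d M -> orbit_mx p d M M' -> Mset p d M'.
Proof. by move=> SM /(orbit_mxP p_prime M' SM)[]. Qed.

Lemma orbit_mx_refl M : Mset p d M -> orbit_mx p d M M.
Proof.
move=> SM; have [S [pr mS]] := Mset_model SM.
by rewrite -(isomorphic_models SM SM mS mS); exact: isomorphic_refl.
Qed.

(** Symmetry and transitivity are borrowed from [isomorphic] through models, without composing or
    inverting automorphisms. *)
Lemma orbit_mx_eq M M' : Mset p d M -> orbit_mx p d M M' ->
  orbit_mx p d M = orbit_mx p d M'.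
Proof.
move=> SM O; have SM' := orbit_mx_sub SM O.
have [S [pr mS]] := Mset_model SM; have [S' [pr' mS']] := Mset_model SM'.
have iso := (isomorphic_models SM SM' mS mS').2 O.
apply/seteqP; split=> A OA.
  have SA := orbit_mx_sub SM OA; have [T [q mT]] := Mset_model SA.
  rewrite -(isomorphic_models SM' SA mS' mT).
  apply: isomorphic_trans (isomorphic_sym iso) _.
  by rewrite (isomorphic_models SM SA mS mT).
have SA := orbit_mx_sub SM' OA; have [T [q mT]] := Mset_model SA.
rewrite -(isomorphic_models SM SA mS mT).
apply: isomorphic_trans iso _.
by rewrite (isomorphic_models SM' SA mS' mT).
Qed.

Definition mx_class (M : 'M[int]_n) (T : braiding) : Prop :=
  AS T /\ exists (S : braiding) (pr : {poly int} -> S), models M pr /\ isomorphic S T.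

Lemma mx_classE M (S : braiding) (pr : {poly int} -> S) : Mset p d M -> models M pr ->
  mx_class M = (fun T => AS T /\ isomorphic S T).
Proof.
move=> SM mS; apply/funext => T; apply/propext; split=> -[AT].
  move=> [S' [pr' [mS' iso]]]; split=> //; apply: isomorphic_trans iso.
  by rewrite (isomorphic_models SM SM mS mS'); exact: orbit_mx_refl.
by move=> iso; split=> //; exists S, pr.
Qed.

Lemma mx_class_iso M : Mset p d M -> iso_classes AS (mx_class M).
Proof.
move=> SM; have [S [pr mS]] := Mset_model SM.
by exists S; [exact: model_AbSol mS | exact: mx_classE mS].
Qed.

Lemma iso_class_mx C : iso_classes AS C -> exists2 M, Mset p d M & C = mx_class M.
Proof.
move=> [S AS_S ->]; have [M [SM [pr mS]]] := AbSol_model AS_S.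
by exists M => //; rewrite (mx_classE SM mS).
Qed.

Lemma mx_class_eq M M' : Mset p d M -> Mset p d M' ->
  mx_class M = mx_class M' <-> orbit_mx p d M M'.
Proof.
move=> SM SM'.
have [S [pr mS]] := Mset_model SM; have [S' [pr' mS']] := Mset_model SM'.
rewrite -(isomorphic_models SM SM' mS mS') (mx_classE SM mS) (mx_classE SM' mS').
split=> [E|iso].
  have : AS S' /\ isomorphic S' S' by split; [exact: model_AbSol mS' | exact: isomorphic_refl].
  by rewrite -(congr1 (fun P : braiding -> Prop => P S') E) => -[].
apply/funext => T; apply/propext; split=> -[AT] isoT; split=> //.
  exact: isomorphic_trans (isomorphic_sym iso) isoT.
exact: isomorphic_trans iso isoT.
Qed.

Lemma orbit_correspondence : exists f : (braiding -> Prop) -> set 'M[int]_n,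
  bij_between (iso_classes AS) (orbits p d) f.
Proof.
(* Any matrix of the class serves, since all of them lie in one orbit; the default 0 is not reached
   on isomorphism classes. *)
exists (fun C => orbit_mx p d (xget 0 [set M | Mset p d M /\ C = mx_class M])); split.
- move=> C /iso_class_mx[M SM EC]; case: xgetP => [M' _ [SM' _]|/(_ M)[]] //.
  by exists M'.
- move=> C C' /iso_class_mx[M SM EC] /iso_class_mx[M' SM' EC'].
  case: xgetP => [A _ [SA ->]|/(_ M)[]] //.
  case: xgetP => [A' _ [SA' ->]|/(_ M')[]] //.
  by move=> E; apply/(mx_class_eq SA SA'); rewrite E; exact: orbit_mx_refl.
move=> _ [M SM <-]; exists (mx_class M); first exact: mx_class_iso.
case: xgetP => [A _ [SA /esym/(mx_class_eq SA SM) OA]|/(_ M)[]] //.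
exact: orbit_mx_eq.
Qed.

Lemma finite_Mset : finite_set (Mset p d).
Proof.
pose K := (\sum_i p ^ d i).+1.
pose g (t : {ffun 'I_n * 'I_n -> 'I_K}) : 'M[int]_n := \matrix_(i, j) (t (i, j) : nat)%:Z.
apply: (@sub_finite_set _ _ (g @` [set: {ffun 'I_n * 'I_n -> 'I_K}])); last first.
  exact: finite_image.
move=> M [_ M_ge0 M_lt _ M_diag].
exists [ffun u => inord `|M u.1 u.2|%N] => //.
apply/matrixP => i j; rewrite mxE ffunE /= inordK ?gez0_abs //.
rewrite ltnS; apply: (@leq_trans (p ^ d j)); last by rewrite (bigD1 j) //= leq_addr.
rewrite -lez_nat gez0_abs // -M_diag; case: (eqVneq i j) => [->//|ij].
exact: ltW (M_lt i j ij).
Qed.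

(** An orbit with s elements contributes s terms 1/s, so the sum counts orbits. The type [L] makes
    [Mset] a finite type, whose partition into orbits can be summed over. *)
Lemma orbit_count : exists N : nat, has_card (iso_classes AS) N /\
  N%:R = \sum_(M \in Mset p d) (#|` fset_set (orbit_mx p d M)|%:R : rat)^-1.
Proof.
pose L := fset_set (Mset p d).
have LP (x : L) : Mset p d (val x).
  by have := valP x; rewrite in_fset_set ?inE //; exact: finite_Mset.
have inL M : Mset p d M -> M \in L.
  by move=> SM; rewrite in_fset_set ?inE //; exact: finite_Mset.
pose E (x y : L) : bool := `[< orbit_mx p d (val x) (val y) >].
have EP x y : E x y <-> orbit_mx p d (val x) = orbit_mx p d (val y).
  split=> [/asboolP O|O]; first exact: orbit_mx_eq.
  by apply/asboolP; rewrite O; exact: orbit_mx_refl.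
have Eequiv : {in [set: L]%SET & &, equivalence_rel E}.
  move=> x y z _ _ _; split; first by apply/EP.
  by move=> /EP Exy; apply/idP/idP => /EP H; apply/EP; rewrite ?Exy // -Exy.
pose Q := equivalence_partition E [set: L]%SET.
have partQ : finset.partition Q [set: L]%SET.
  by apply: finset.equivalence_partitionP; exact: Eequiv.
have QP A : A \in Q -> exists x : L, A = [set y | E x y]%SET.
  by move=> /imsetP[x _ ->]; exists x; apply/setP => y; rewrite !finset.inE.
exists #|Q|; split.
  have rP (k : 'I_#|Q|) : exists x : L, enum_val k = [set y | E x y]%SET.
    exact: QP (enum_valP k).
  pose r k := sval (cid (rP k)).
  have rE k : enum_val k = [set y | E (r k) y]%SET by exact: svalP (cid (rP k)).
  exists (fun k => mx_class (val (r k))); split.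
  - by move=> k _; apply: mx_class_iso; exact: LP.
  - move=> k l _ _ /(mx_class_eq (LP _) (LP _)) O; apply: enum_val_inj.
    rewrite !rE; apply/setP => y; rewrite !finset.inE.
    have /EP Ekl : E (r k) (r l) by apply/asboolP.
    by apply/idP/idP => /EP H; apply/EP; rewrite -?Ekl // Ekl.
  move=> C /iso_class_mx[M SM ->].
  pose x : L := [` inL M SM]%fset.
  have xQ : [set y | E x y]%SET \in Q.
    by apply/imsetP; exists x => //; apply/setP => y; rewrite !finset.inE.
  exists (enum_rank_in xQ [set y | E x y]%SET) => //.
  set k := enum_rank_in _ _.
  have := rE k; rewrite enum_rankK_in // => /setP/(_ x); rewrite !finset.inE.
  have -> : E x x by apply/EP.
  by move=> /esym/asboolP O; apply/(mx_class_eq (LP _) SM).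
rewrite fsbig_finite /=; last exact: finite_Mset.
rewrite -/L big_seq_fsetE /=.
have -> : \sum_(x : L) (#|` fset_set (orbit_mx p d (fsval x))|%:R : rat)^-1 =
    \sum_(x in [set: L]%SET) (#|[set y | E x y]%SET|%:R)^-1.
  rewrite [RHS]big_mkcond /=; apply: eq_bigr => x _; rewrite finset.inE /=.
  have finO : finite_set (orbit_mx p d (fsval x)).
    apply: sub_finite_set finite_Mset => A; exact: (orbit_mx_sub (LP x)).
  have subL : (fset_set (orbit_mx p d (fsval x)) `<=` L)%fset.
    apply/fsubsetP => M; rewrite in_fset_set // inE => O.
    by apply: inL; exact: (orbit_mx_sub (LP x)).
  congr (_%:R^-1); rewrite -(card_fsub subL); apply: eq_card => y.
  by rewrite !finset.inE in_fset_set //; apply/idP/asboolP; rewrite inE.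
rewrite (set_partition_big _ partQ) /=.
rewrite (eq_bigr (fun=> 1)) ?sumr_const // => A /QP[x ->].
rewrite (eq_bigr (fun=> (#|[set y | E x y]%SET|%:R)^-1)) => [|y].
  rewrite sumr_const -[_ *+ _]mulr_natr mulVf // pnatr_eq0 -lt0n.
  by apply/card_gt0P; exists x; rewrite finset.inE; apply/EP.
rewrite finset.inE => /EP Exy; congr (_%:R^-1); apply: eq_card => z.
by rewrite !finset.inE; apply/idP/idP => /EP H; apply/EP; rewrite -?Exy // Exy.
Qed.

End Correspondence.

Theorem theorem7p26 (p n : nat) (d : 'I_n -> nat) :
  prime p -> (1 <= n)%N ->
  (forall i j : 'I_n, (i <= j)%N -> (d j <= d i)%N) ->
  (exists f : (braiding -> Prop) -> set 'M[int]_n,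
     bij_between (iso_classes (AbSol (fun i => p ^ d i)%N)) (orbits p d) f) /\
  (finite_set (Mset p d) /\
   exists N : nat,
     has_card (iso_classes (AbSol (fun i => p ^ d i)%N)) N /\
     N%:R = (\sum_(M \in Mset p d)
               (#|` fset_set (orbit_mx p d M)|%:R : rat)^-1)).
Proof.
move=> p_prime _ _; split; first exact: orbit_correspondence.
by split; [exact: finite_Mset | exact: orbit_count].
Qed.
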